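(* Let $r\geq 3$ and $k\geq 1$ be integers. There exists $n_0=n_0(r,k)$ such that for every integer $n\geq n_0$, writing $n=qr+p$ with integers $q$ and $0\leq p\leq r-1$, the following hold. (a) ${\rm ex}_{r+1}(n,B_{r,k})=\left(1-\frac{1}{r}\right)\frac{n^2}{2}-\frac{n}{r}+\frac{p(p+2)}{2r}-\frac{p}{2}+1$. (b) ${\rm Ex}_{r+1}(n,B_{r,k})$ equals $\mathcal{G}_1[n]\cup\mathcal{G}_2[n]$ if $p=0$; equals $\mathcal{G}_1[n]\cup\mathcal{G}_2[n]\cup\mathcal{G}_3[n]$ if $1\leq p\leq r-3$; equals $\mathcal{G}_2[n]\cup\mathcal{G}_3[n]$ if $p=r-2$; and equals $\mathcal{G}_3[n]$ if $p=r-1$.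
   Context: All graphs are finite and simple. For $r\geq 3$, $k\geq1$, the generalized book graph $B_{r,k}=K_r\vee kK_1$ is obtained by joining every vertex of $K_r$ to every vertex of an independent set of size $k$. A graph is $H$-free if it has no subgraph isomorphic to $H$. A graph is $r$-partite if its vertex set can be partitioned into $r$ (possibly empty) independent sets; non-$r$-partite otherwise. For a graph $H$ with chromatic number $r+1$, ${\rm ex}_{r+1}(n,H)$ is the maximum number of edges of a non-$r$-partite $H$-free graph on $n$ vertices, and ${\rm Ex}_{r+1}(n,H)$ is the set of all non-$r$-partite $H$-free $n$-vertex graphs with exactly ${\rm ex}_{r+1}(n,H)$ edges. $T_m(N)$ denotes the Turán graph: the complete $m$-partite graph on $N$ vertices with part sizes differing by at most one. $H_1\vee H_2$ denotes the join (disjoint union plus all edges between $H_1$ and $H_2$). For nonnegative integers $n_1,\dots,n_5$, $C_5[n_1,n_2,n_3,n_4,n_5]$ is the blow-up of the 5-cycle $v_1v_2v_3v_4v_5v_1$: each $v_i$ is replaced by an independent set $I_i$ of size $n_i$, and all edges are added between $I_i$ and $I_{i+1}$ for $1\leq i\leq 4$ and between $I_1$ and $I_5$. For even $m\geq 6$: $\mathcal{C}_5^1[m]=\{C_5[\frac m2-2,t,1,1,\frac m2-t]:1\leq t\leq \frac m2-1\}$ and $\mathcal{C}_5^2[m]=\{C_5[\frac m2-1,t,1,1,\frac m2-t-1]:1\leq t\leq \frac m2-2\}$. For odd $m\geq5$: $\mathcal{C}_5^3[m]=\{C_5[\frac{m-1}2-1,t,1,1,\frac{m-1}2-t]:1\leq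 t\leq \frac{m-1}2-1\}$. With $n=qr+p$, $0\le p\le r-1$: $\mathcal{G}_1[n]=\{F\vee T_{r-2}(q(r-2)+p+1):F\in\mathcal{C}_5^3[2q-1]\}$; $\mathcal{G}_2[n]=\{F\vee T_{r-2}(q(r-2)+p):F\in\mathcal{C}_5^1[2q]\cup\mathcal{C}_5^2[2q]\}$; $\mathcal{G}_3[n]=\{F\vee T_{r-2}(q(r-2)+p-1):F\in\mathcal{C}_5^3[2q+1]\}$. *)

(* Defs.v *)
From HB Require Import structures.
From mathcomp Require Import all_boot all_order all_algebra.

Set Implicit Arguments.
Unset Strict Implicit.
Unset Printing Implicit Defensive.

(* A finite simple graph on V, given by its edge set: a set of 2-subsets of V. *)
Record graph (V : finType) := Graph {
  edges : {set {set V}};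
  edges_card2 : [forall e in edges, #|e| == 2]
}.

HB.instance Definition _ (V : finType) := [isSub for @edges V].
HB.instance Definition _ (V : finType) := [Finite of graph V by <:].

Definition adj (V : finType) (G : graph V) : rel V :=
  fun x y => [set x; y] \in edges G.

Lemma graph_of_subproof (V : finType) (e : rel V) :
  [forall A in [set A : {set V} |
     [exists x, exists y, [&& x != y, e x y & A == [set x; y]]]], #|A| == 2].
Proof.
apply/forall_inP => A; rewrite inE => /existsP[x /existsP[y]].
by case/and3P=> xy _ /eqP ->; rewrite cards2 xy.
Qed.

(* The simple graph underlying e: loops are dropped and e is symmetrized,
   see adj_graph_of. *)
Definition graph_of (V : finType) (e : rel V) : graph V :=
  Graph (graph_of_subproof e).

Lemma adj_graph_of (V : finType) (e : rel V) (x y : V) :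
  adj (graph_of e) x y = (x != y) && (e x y || e y x).
Proof.
rewrite /adj inE; apply/idP/idP.
  case/existsP=> a /existsP[b /and3P[ab eab /eqP xyE]].
  have : a \in [set x; y] by rewrite xyE set21.
  have : b \in [set x; y] by rewrite xyE set22.
  have xy : x != y by have := cards2 x y; rewrite xyE cards2 ab; case: (x != y).
  rewrite xy !inE => /orP[] /eqP bE /orP[] /eqP aE; subst a b;
    rewrite ?eqxx // in ab; rewrite eab ?orbT //.
case/andP=> xy /orP[] e1.
  by apply/existsP; exists x; apply/existsP; exists y; rewrite xy e1 eqxx.
apply/existsP; exists y; apply/existsP; exists x.
by rewrite eq_sym xy e1 setUC eqxx.
Qed.

Definition isomorphic (V W : finType) (G : graph V) (H : graph W) : Prop :=
  exists f : V -> W, bijective f /\ forall x y, adj H (f x) (f y) = adj G x y.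

(* G has a (not necessarily induced) subgraph isomorphic to H. *)
Definition contains (V W : finType) (G : graph V) (H : graph W) : bool :=
  [exists f : {ffun W -> V}, injectiveb f &&
     [forall x, forall y, adj H x y ==> adj G (f x) (f y)]].

Definition independent (V : finType) (G : graph V) (A : {set V}) : bool :=
  [forall x in A, forall y in A, ~~ adj G x y].

Definition rpartite (r : nat) (V : finType) (G : graph V) : bool :=
  [exists c : {ffun V -> 'I_r}, [forall i, independent G [set x | c x == i]]].

Definition admissible (r : nat) (W : finType) (H : graph W)
    (V : finType) (G : graph V) : bool :=
  ~~ rpartite r G && ~~ contains G H.

(* ex_{r+1}(n, H); the index r of ex_succ and Ex_succ is chi(H) - 1. *)
Definition ex_succ (r n : nat) (W : finType) (H : graph W) : nat :=
  \max_(G : graph 'I_n | admissible r H G) #|edges G|.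

(* Classes of graphs on arbitrary finite vertex types; all those defined below
   are invariant under isomorphism. *)
Definition gclass : Type := forall V : finType, graph V -> Prop.

Definition gunion (C D : gclass) : gclass := fun V G => C V G \/ D V G.

Definition gclass_eq (C D : gclass) : Prop :=
  forall (V : finType) (G : graph V), C V G <-> D V G.

Definition Ex_succ (r n : nat) (W : finType) (H : graph W) : gclass :=
  fun V G => [/\ #|V| = n, admissible r H G & #|edges G| = ex_succ r n H].

Definition complete_graph (n : nat) : graph 'I_n := graph_of (fun _ _ => true).

Definition empty_graph (n : nat) : graph 'I_n := graph_of (fun _ _ => false).

Definition join (V W : finType) (G : graph V) (H : graph W) : graph (V + W)%type :=
  graph_of (fun a b : V + W =>
    match a, b with
    | inl x, inl y => adj G x y
    | inr x, inr y => adj H x y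
    | _, _ => true
    end).

Definition book (r k : nat) : graph ('I_r + 'I_k)%type :=
  join (complete_graph r) (empty_graph k).

(* For 0 < m, the parts are the residue classes mod m, whose sizes differ by
   at most one. *)
Definition turan (m N : nat) : graph 'I_N :=
  graph_of (fun x y : 'I_N => x %% m != y %% m).

Definition cycle5 : graph 'I_5 := graph_of (fun i j : 'I_5 => j == i.+1 %% 5 :> nat).

Definition blowup (V : finType) (H : graph V) (s : V -> nat) :
    graph {v : V & 'I_(s v)} :=
  graph_of (fun a b : {v : V & 'I_(s v)} => adj H (tag a) (tag b)).

Definition C5 (n1 n2 n3 n4 n5 : nat) :=
  blowup cycle5 (fun i : 'I_5 => nth 0 [:: n1; n2; n3; n4; n5] i).

(* C5_1 and C5_2 are meant for even m >= 6, C5_3 for odd m >= 5; outside these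
   ranges truncated subtraction makes them meaningless. *)
Definition C5_1 (m : nat) : gclass := fun V F =>
  exists t : nat, (1 <= t <= m %/ 2 - 1) /\
    isomorphic F (C5 (m %/ 2 - 2) t 1 1 (m %/ 2 - t)).

Definition C5_2 (m : nat) : gclass := fun V F =>
  exists t : nat, (1 <= t <= m %/ 2 - 2) /\
    isomorphic F (C5 (m %/ 2 - 1) t 1 1 (m %/ 2 - t - 1)).

Definition C5_3 (m : nat) : gclass := fun V F =>
  exists t : nat, (1 <= t <= (m - 1) %/ 2 - 1) /\
    isomorphic F (C5 ((m - 1) %/ 2 - 1) t 1 1 ((m - 1) %/ 2 - t)).

Definition join_class (C : gclass) (W : finType) (H : graph W) : gclass :=
  fun V G => exists (U : finType) (F : graph U), C U F /\ isomorphic G (join F H).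

(* For n = q * r + p with p < r. *)
Definition G1 (r q p : nat) : gclass :=
  join_class (C5_3 (2 * q - 1)) (turan (r - 2) (q * (r - 2) + p + 1)).

Definition G2 (r q p : nat) : gclass :=
  join_class (gunion (C5_1 (2 * q)) (C5_2 (2 * q)))
    (turan (r - 2) (q * (r - 2) + p)).

Definition G3 (r q p : nat) : gclass :=
  join_class (C5_3 (2 * q + 1)) (turan (r - 2) (q * (r - 2) + p - 1)).

(* Main.v *)
(* Vertices of degree at most about (1 - 1/r) n - n / r^3 are deleted one at a
   time until a graph is reached from which no further vertex can be deleted.
   Such a graph is K_{r+1}-free, since a K_{r+1} whose vertices have large degree
   contains a K_r with linearly many common neighbours, and an argument in the
   style of Andrasfai, Erdos and Sos makes it r-colorable.  Each deletion
   increases the surplus over the claimed maximum, so for large n an extremal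
   graph becomes r-colorable after deleting one vertex x.

   Let V_1, ..., V_r be the color classes of G - x and D_i the neighbours of x in
   V_i; no D_i is empty.  A K_{r+1} would force about n non-edges, while only
   about 2n/r are affordable; this is where r >= 3 enters.  So no choice of one
   vertex in each D_i is a clique, and counting such choices gives at least
   min |D_a| |D_b| non-edges.  Together with (|D_a| - 1)(|D_b| - 1) >= 0 this
   bounds the size by a quadratic form in |V_a| + 1, |V_b| + 1 and the other
   |V_i|, which is maximal exactly when these r numbers, whose sum is n + 1, are
   balanced.  Equality forces |D_a| = 1 (up to symmetry) and the C_5 structure. *)

Require Import Defs.
From mathcomp Require Import all_boot all_order all_algebra.
From mathcomp Require Import zify ring lra.

Set Implicit Arguments.
Unset Strict Implicit.
Unset Printing Implicit Defensive.

Lemma leq_card_bigcup (I T : finType) (P : pred I) (F : I -> {set T}) :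
  #|\bigcup_(i | P i) F i| <= \sum_(i | P i) #|F i|.
Proof.
elim/big_rec2: _ => [|i n B _ IH]; first by rewrite cards0.
by rewrite (leq_trans (leq_card_setU _ _)) // leq_add2l.
Qed.

(** * Cliques, degrees and colorings *)

Section Basics.
Variables (V : finType) (G : graph V).
Implicit Types (A B S : {set V}) (u v x y : V).

Lemma adjC u v : adj G u v = adj G v u.
Proof. by rewrite /adj setUC. Qed.

Lemma adjxx u : adj G u u = false.
Proof.
apply/negP => Guu; have /forall_inP/(_ _ Guu) := edges_card2 G.
by rewrite setUid cards1.
Qed.

Lemma adj_neq u v : adj G u v -> u != v.
Proof. by apply: contraTneq => ->; rewrite adjxx. Qed.

Definition clique S := [forall u in S, forall v in S, (u != v) ==> adj G u v].
Definition common_nbr A S := [set u in A | [forall s in S, adj G s u]].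
(** A vertex [v] of [A] belongs to its own set of non-neighbours. *)
Definition non_nbr A v := [set u in A | ~~ adj G v u].
Definition deg A v := #|[set u in A | adj G v u]|.
(* Ordered pairs are counted, so this is twice the number of edges: arcs_edges. *)
Definition arcs A := \sum_(u in A) \sum_(v in A) adj G u v.
Definition book_free r k :=
  forall S, clique S -> #|S| = r -> #|common_nbr setT S| < k.
Definition clique_free A r := forall S, S \subset A -> clique S -> #|S| != r.
Definition proper_coloring r A (c : V -> 'I_r) :=
  {in A &, forall u v, adj G u v -> c u != c v}.

Lemma cliqueP S :
  reflect {in S &, forall u v, u != v -> adj G u v} (clique S).
Proof.
apply: (iffP forall_inP) => [cS u v Su Sv uv | cS u Su].
  by move/forall_inP: (cS u Su) => /(_ v Sv) /implyP; apply.
by apply/forall_inP => v Sv; apply/implyP; apply: cS.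
Qed.

Lemma cliqueS S S' : S' \subset S -> clique S -> clique S'.
Proof.
by move=> /subsetP sub /cliqueP cS; apply/cliqueP => u v /sub ? /sub ?; apply: cS.
Qed.

Lemma common_nbrP A S u :
  reflect (u \in A /\ {in S, forall s, adj G s u}) (u \in common_nbr A S).
Proof. by rewrite inE; apply: (iffP andP) => -[-> /forall_inP]. Qed.

Lemma clique1U x S : clique S -> x \in common_nbr setT S -> clique (x |: S).
Proof.
move=> /cliqueP cS /common_nbrP[_ xS]; apply/cliqueP => u v.
rewrite !inE => /orP[/eqP->|Su] /orP[/eqP->|Sv]; first by rewrite eqxx.
- by rewrite adjC xS.
- by rewrite xS.
- exact: cS.
Qed.

Lemma common_nbr_notin A S u : u \in common_nbr A S -> u \notin S.
Proof. by move=> /common_nbrP[_ uS]; apply/negP => /uS; rewrite adjxx. Qed.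

Lemma card_clique1U x S : x \in common_nbr setT S -> #|x |: S| = #|S|.+1.
Proof. by move/common_nbr_notin=> xS; rewrite cardsU1 xS. Qed.

Lemma deg_non_nbr A v : deg A v + #|non_nbr A v| = #|A|.
Proof.
rewrite /deg -[RHS](cardsID [set u | adj G v u]); congr addn.
  by apply: eq_card => u; rewrite !inE.
by apply: eq_card => u; rewrite !inE andbC.
Qed.

Lemma sum_adj A v : \sum_(u in A) adj G v u = deg A v.
Proof.
rewrite /deg -sum1_card big_mkcond [RHS]big_mkcond; apply: eq_bigr => u _.
by rewrite inE; case: (u \in A); case: adj.
Qed.

Lemma arcsD1 A x : x \in A -> arcs A = arcs (A :\ x) + (deg A x).*2.
Proof.
move=> Ax; rewrite /arcs (big_setD1 x Ax) /= sum_adj -addnn addnC addnA.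
congr addn.
rewrite -[in RHS]sum_adj (big_setD1 x Ax) /= adjxx add0n -big_split /=.
apply: eq_bigr => u _; rewrite (big_setD1 x Ax) /= addnC; congr addn.
by rewrite adjC.
Qed.

Lemma arcs_le A : arcs A <= #|A| ^ 2.
Proof.
rewrite -mulnn -sum_nat_const; apply: leq_sum => u _.
by rewrite -sum1_card; apply: leq_sum => v _; case: adj.
Qed.

Lemma rpartiteP r : reflect (exists c : V -> 'I_r, proper_coloring setT c) (rpartite r G).
Proof.
apply: (iffP existsP) => [[c /forallP cP]|[c cP]].
  exists c => u v _ _ uv; apply: contraL uv => /eqP cuv.
  by move/forall_inP: (cP (c u)) => /(_ u); rewrite inE eqxx =>
    /(_ isT) /forall_inP /(_ v); rewrite inE cuv eqxx; apply.
exists [ffun u => c u]; apply/forallP => i; apply/forall_inP => u.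
rewrite inE ffunE => /eqP cu; apply/forall_inP => v.
rewrite inE ffunE => /eqP cv; apply/negP => /(cP u v).
by rewrite !inE cu cv eqxx => /(_ isT isT).
Qed.

(** Unlike [rpartite] this is relative to a vertex set, so that deleting vertices never changes the
    type of the graph. *)
Definition colorable r A := [exists c : {ffun V -> 'I_r},
  [forall u in A, forall v in A, adj G u v ==> (c u != c v)]].

Lemma colorableP r A :
  reflect (exists c : V -> 'I_r, proper_coloring A c) (colorable r A).
Proof.
apply: (iffP existsP) => [[c /forall_inP cP]|[c cP]].
  by exists c => u v uA vA; have /forall_inP/(_ v vA)/implyP := cP u uA.
exists [ffun u => c u]; apply/forall_inP => u uA; apply/forall_inP => v vA.
by apply/implyP; rewrite !ffunE; apply: cP.
Qed.

Lemma arcs_edges : arcs setT = #|edges G|.*2.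
Proof.
rewrite /arcs pair_big /=.
transitivity (\sum_(p : V * V | adj G p.1 p.2) 1).
  by rewrite big_mkcond [RHS]big_mkcond; apply: eq_bigr => p _; rewrite !inE; case: adj.
rewrite (partition_big (fun p => [set p.1; p.2]) (mem (edges G))) //=.
rewrite -muln2 -sum_nat_const; apply: eq_bigr => e Ge.
have /cards2P[a [b [ab eE]]] : #|e| == 2.
  by have /forall_inP := edges_card2 G; apply.
have abG : adj G a b by rewrite /adj -eE.
rewrite sum1dep_card (_ : [set _ | _] = [set (a, b); (b, a)]).
  by rewrite cards2 xpair_eqE negb_and ab.
apply/setP => -[u v]; rewrite !inE /= !xpair_eqE; apply/andP/orP.
  case=> uv /eqP uvE.
  have : u \in e by rewrite -uvE set21.
  have : v \in e by rewrite -uvE set22.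
  have uNv := adj_neq uv.
  rewrite eE !inE => /orP[]/eqP vE /orP[]/eqP uE; subst u v;
    rewrite ?eqxx ?(negPf uNv) //= in uNv *; [right | left] => //.
case=> /andP[/eqP-> /eqP->]; rewrite ?abG ?[adj _ b a]adjC ?abG eE //.
by rewrite setUC.
Qed.

(** Containment need not be induced, so any [k] common neighbours of an r-clique serve as pages,
    whatever edges they span. *)
Lemma contains_book r k S :
  clique S -> #|S| = r -> k <= #|common_nbr setT S| -> contains G (book r k).
Proof.
move=> /cliqueP cS Sr kS; set N := common_nbr _ _ in kS.
pose f (w : 'I_r + 'I_k) : V :=
  match w with
  | inl i => enum_val (cast_ord (esym Sr) i)
  | inr j => enum_val (widen_ord kS j)
  end.
have fS i : f (inl i) \in S by apply: enum_valP.
have fN j : f (inr j) \in N by apply: enum_valP.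
have f1 : injective (fun i => f (inl i)).
  by move=> i j /enum_val_inj /(congr1 val) /= ij; apply: val_inj.
apply/existsP; exists [ffun w => f w]; apply/andP; split.
  apply/injectiveP => -[i|i] [j|j]; rewrite !ffunE => fE.
  - by congr inl; apply: f1.
  - by have := common_nbr_notin (fN j); rewrite -fE fS.
  - by have := common_nbr_notin (fN i); rewrite fE fS.
  - by congr inr; apply/val_inj; have /(congr1 val) := enum_val_inj fE.
apply/forallP => u; apply/forallP => v; apply/implyP.
rewrite !ffunE adj_graph_of; case: u v => [i|i] [j|j] /andP[uv] //.
- by move=> _; apply: cS => //; apply: contraNneq uv => /f1 ->.
- by move=> _; have /common_nbrP[_] := fN j; apply.
- by move=> _; rewrite adjC; have /common_nbrP[_] := fN i; apply.
- by rewrite !adj_graph_of !andbF.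
Qed.

(** The spine of a book and its first page form a clique on r + 1 vertices. *)
Lemma clique_free_contains r k :
  0 < k -> clique_free setT r.+1 -> ~~ contains G (book r k).
Proof.
case: k => // k _ cf; apply/existsP => -[f /andP[/injectiveP finj /forallP fadj]].
pose g (i : 'I_r.+1) := if unlift ord_max i is Some j then f (inl j) else f (inr ord0).
have ginj : injective g.
  move=> i j; rewrite /g; case: unliftP => [i'|] ->; case: unliftP => [j'|] -> //.
  - by move/finj=> [->].
  - by move/finj.
  - by move/finj.
have := cf (g @: setT) (subsetT _).
rewrite card_imset // cardsT card_ord eqxx => /(_ _)/negP; apply=> //.
apply/cliqueP => _ _ /imsetP[i _ ->] /imsetP[j _ ->].
rewrite /g; case: unliftP => [i'|] _; case: unliftP => [j'|] _ uv.
all: apply: (implyP (forallP (fadj _) _)); rewrite adj_graph_of //=.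
- rewrite adj_graph_of; apply/andP; split; first by apply: contraNneq uv => ->.
  by apply/orP; left; rewrite andbT; apply: contraNneq uv => ->.
- by rewrite eqxx in uv.
Qed.

End Basics.

(** * Colorability of graphs of large minimum degree *)

Section MinDegree.
Variables (V : finType) (G : graph V) (r : nat) (A : {set V}) (D : nat).
Hypothesis AD : {in A, forall v, #|non_nbr G A v| <= D}.
Implicit Types (B S K P : {set V}) (u v x y : V).

(** Each chosen vertex costs at most [D] candidates, itself included, and the last choice only needs
    one candidate left. *)
Lemma clique_greedy j B :
  B \subset A -> j.-1 * D < #|B| -> exists S, [/\ S \subset B, clique G S & #|S| = j].
Proof.
elim: j B => [|j IHj] B BA Bj.
  exists set0; split; rewrite ?sub0set ?cards0 //.
  by apply/cliqueP => u; rewrite inE.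
have [u uB] : exists u, u \in B by apply/card_gt0P; lia.
have uA := subsetP BA u uB.
case: j IHj Bj => [|j] IHj Bj.
  exists [set u]; rewrite sub1set cards1; split=> //.
  by apply/cliqueP => x y /set1P-> /set1P->; rewrite eqxx.
pose B' := [set v in B | adj G u v].
have B'B : B' \subset B by apply/subsetP => v; rewrite inE => /andP[].
have B'j : j.+1.-1 * D < #|B'|.
  have := AD uA; have := deg_non_nbr G B u; rewrite /deg -/B'.
  have : #|non_nbr G B u| <= #|non_nbr G A u|.
    by apply/subset_leq_card/subsetP => v; rewrite !inE => /andP[/(subsetP BA)->].
  move: Bj; rewrite /= mulSn; lia.
have [S [SB' cS Sj]] := IHj _ (subset_trans B'B BA) B'j.
have uS : u \in common_nbr G setT S.
  apply/common_nbrP; split; rewrite ?inE // => s /(subsetP SB').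
  by rewrite inE adjC => /andP[].
exists (u |: S); split; last by rewrite (card_clique1U uS) Sj.
  by rewrite subUset sub1set uB (subset_trans SB').
exact: clique1U.
Qed.

Lemma card_common_nbr S : S \subset A -> #|A| <= #|common_nbr G A S| + #|S| * D.
Proof.
move=> SA; rewrite -(cardsID (common_nbr G A S)); apply: leq_add.
  by apply/subset_leq_card/subsetIr.
apply: (@leq_trans #|\bigcup_(s in S) non_nbr G A s|).
  apply/subset_leq_card/subsetP => u; rewrite !inE => /andP[+ uA].
  rewrite uA /= => /forall_inPn[s Ss su]; apply/bigcupP; exists s => //.
  by rewrite inE uA.
rewrite -sum_nat_const (leq_trans (leq_card_bigcup _ _)) //.
by apply: leq_sum => s /(subsetP SA); apply: AD.
Qed.

(* A substitute for being in the same class of a complete r-partite graph: twins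
   are non-adjacent in a K_{r+1}-free graph, and twins_trans makes the relation
   transitive when the degrees are large. *)
Definition twins x y := [exists P : {set V},
  [&& P \subset common_nbr G A [set x; y], clique G P & #|P| == r.-1]].

Lemma twinsP x y : reflect (exists P,
  [/\ P \subset common_nbr G A [set x; y], clique G P & #|P| = r.-1]) (twins x y).
Proof.
apply: (iffP existsP) => -[P]; first by case/and3P => ? ? /eqP; exists P.
by case=> ? ? Pr; exists P; apply/and3P; split=> //; apply/eqP.
Qed.

Lemma twinsC x y : twins x y = twins y x.
Proof. by rewrite /twins setUC. Qed.

Hypotheses (r2 : 1 < r) (cfA : clique_free G A r.+1).

Lemma common_nbr_clique_indep P x y :
  P \subset A -> clique G P -> #|P| = r.-1 ->
  x \in common_nbr G A P -> y \in common_nbr G A P -> ~~ adj G x y.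
Proof.
move=> PA cP Pr xP yP; apply/negP => xy.
have yP' : y \in common_nbr G setT P.
  by apply/common_nbrP; split; [rewrite inE | case/common_nbrP: yP].
have xP' : x \in common_nbr G setT (y |: P).
  apply/common_nbrP; split; rewrite ?inE // => s /setU1P[->|]; first by rewrite adjC.
  by case/common_nbrP: xP => _; apply.
have := cfA (S := x |: (y |: P)).
rewrite (card_clique1U xP') (card_clique1U yP') Pr prednK ?eqxx; last lia.
move=> /(_ _ _)/negP; apply=> //; last by do 2?apply: clique1U.
rewrite !subUset !sub1set PA.
by case/common_nbrP: xP => ->; case/common_nbrP: yP => ->.
Qed.

(** The common neighbourhood of the clique that witnesses [twins x y] is independent, contains both
    [x] and [y], and is large. *)
Lemma twins_sub x y : twins x y -> x \in A -> y \in A ->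
  exists U : {set V},
    U \subset non_nbr G A x :&: non_nbr G A y /\ #|A| <= #|U| + r.-1 * D.
Proof.
move=> /twinsP[Q [/subsetP QN cQ Qr]] xA yA; exists (common_nbr G A Q).
have QA : Q \subset A by apply/subsetP => u /QN/common_nbrP[].
split; last by rewrite -Qr card_common_nbr.
have xQ : x \in common_nbr G A Q.
  by apply/common_nbrP; split=> // s /QN/common_nbrP[_ sN]; rewrite adjC sN ?set21.
have yQ : y \in common_nbr G A Q.
  by apply/common_nbrP; split=> // s /QN/common_nbrP[_ sN]; rewrite adjC sN ?set22.
apply/subsetP => u uQ; have uA : u \in A by case/common_nbrP: uQ.
by rewrite !inE uA !(@common_nbr_clique_indep Q).
Qed.

(** Here more than (r - 2) D common neighbours of [x] and [y] remain, enough for a greedy clique of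
    size r - 1. *)
Lemma twins_non_nbrU x y : x \in A -> y \in A ->
  #|non_nbr G A x :|: non_nbr G A y| + r.-2 * D < #|A| -> twins x y.
Proof.
move=> xA yA xyD.
have [||S [SN cS Sr]] := @clique_greedy r.-1 (common_nbr G A [set x; y]).
- by apply/subsetP => u; rewrite inE => /andP[].
- move: xyD; rewrite -(cardsID (common_nbr G A [set x; y]) A).
  set a := #|_ :|: _|; set b := #|A :&: _|; set c := #|A :\: _|.
  have ba : b = #|common_nbr G A [set x; y]|.
    by apply: eq_card => u; rewrite !inE; case: (u \in A).
  suff : c <= a by rewrite -ba; lia.
  apply/subset_leq_card/subsetP => u; rewrite !inE => /andP[+ uA]; rewrite uA /=.
  by move/forall_inPn => [s]; rewrite !inE => /orP[]/eqP-> ->; rewrite ?orbT.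
by apply/twinsP; exists S.
Qed.

Lemma twins_non_adj x y : x \in A -> y \in A -> twins x y -> ~~ adj G x y.
Proof.
move=> xA yA /twinsP[Q [/subsetP QN cQ Qr]]; apply: (@common_nbr_clique_indep Q) => //.
- by apply/subsetP => u /QN/common_nbrP[].
- by apply/common_nbrP; split=> // s /QN/common_nbrP[_ sN]; rewrite adjC sN ?set21.
- by apply/common_nbrP; split=> // s /QN/common_nbrP[_ sN]; rewrite adjC sN ?set22.
Qed.

Hypothesis Dr : (r ^ 2 + r - 1) * D < r.+1 * #|A|.

(** The large sets that [twins_sub] gives for the two pairs both lie among the at most [D]
    non-neighbours of [y], so they overlap. The overlap is missed by [x] and by [z], which makes the
    union of their non-neighbourhoods small. *)
Lemma twins_trans x y z : x \in A -> y \in A -> z \in A ->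
  twins x y -> twins y z -> twins x z.
Proof.
move=> xA yA zA xy yz; apply: twins_non_nbrU => //.
have [U [UN UD]] := @twins_sub x y xy xA yA.
have [W [WN WD]] := @twins_sub y z yz yA zA.
have cUW : #|U| + #|W| <= #|U :&: W| + D.
  rewrite -cardsUI addnC leq_add2l (leq_trans _ (AD yA)) //.
  apply/subset_leq_card; rewrite subUset (subset_trans UN) ?subsetIr //.
  by rewrite (subset_trans WN) ?subsetIl.
have : #|U :&: W| <= #|non_nbr G A x :&: non_nbr G A z|.
  apply/subset_leq_card/setISS; first exact: subset_trans UN (subsetIl _ _).
  exact: subset_trans WN (subsetIr _ _).
have := cardsUI (non_nbr G A x) (non_nbr G A z).
have := AD xA; have := AD zA.
case: r r2 Dr UD WD => [|[|s]] //= _; nia.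
Qed.

(** Fix an r-clique [K] and color each vertex by a twin of it in [K]. Equal colors make two vertices
    twins by transitivity, hence non-adjacent. *)
Lemma min_degree_colorable : exists c : V -> 'I_r, proper_coloring G A c.
Proof.
have rD : r.-1 * D < #|A| by case: r r2 Dr => [|[|s]] //= _; nia.
have [K [KA cK Kr]] := clique_greedy (subxx _) rD.
have hasP u : u \in A -> exists i : 'I_r, twins u (enum_val (cast_ord (esym Kr) i)).
  move=> uA; suff /exists_inP[v vK uv] : [exists v in K, twins u v].
    exists (cast_ord Kr (enum_rank_in vK v)).
    by rewrite cast_ordK enum_rankK_in.
  (* Without a twin in [K], every v in [K] shares at most r D - |A| non-neighbours with [u], and
     these shared sets cover [non_nbr G A u]. On the other hand the common neighbours of an (r -
     1)-clique in the neighbourhood of [u] are at least |A| - (r - 1) D non-neighbours of [u].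
     Together this gives (r + 1) |A| <= (r^2 + r - 1) D, the negation of [Dr]. *)
  apply: contraT => /exists_inPn noTwin.
  have cover : non_nbr G A u \subset \bigcup_(v in K) (non_nbr G A u :&: non_nbr G A v).
    apply/subsetP => w uw; have wA : w \in A by move: uw; rewrite inE => /andP[].
    have : w \notin common_nbr G setT K.
      apply/negP => wK; have wKA : w |: K \subset A by rewrite subUset sub1set wA.
      by have := cfA wKA (clique1U cK wK); rewrite (card_clique1U wK) Kr eqxx.
    rewrite inE in_setT /= => /forall_inPn[v vK vw]; apply/bigcupP; exists v => //.
    by rewrite inE uw inE wA.
  have small v : v \in K -> #|non_nbr G A u :&: non_nbr G A v| + #|A| <= r * D.
    move=> vK; have vA := subsetP KA v vK.
    have := contra (@twins_non_nbrU u v uA vA) (noTwin v vK).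
    rewrite -leqNgt; have := cardsUI (non_nbr G A u) (non_nbr G A v).
    have := AD uA; have := AD vA; case: r r2 => [|[|s]] //= _; nia.
  have : #|non_nbr G A u| + r * #|A| <= r * (r * D).
    have := leq_trans (subset_leq_card cover) (leq_card_bigcup _ _).
    have := leq_sum (index_enum V) small; rewrite big_split /= !sum_nat_const Kr.
    by move=> H1 H2; apply: leq_trans H1; rewrite leq_add2r.
  have [S [SN cS Sr]] : exists S,
      [/\ S \subset common_nbr G A [set u], clique G S & #|S| = r.-1].
    apply: clique_greedy; first by apply/subsetP => w; rewrite inE => /andP[].
    have := @card_common_nbr [set u]; rewrite sub1set cards1 => /(_ uA).
    by move: rD; case: r r2 => [|[|s]] //= _; nia.
  have := @card_common_nbr S.
  have SA : S \subset A.
    by apply: subset_trans SN _; apply/subsetP => w; rewrite inE => /andP[].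
  have : #|common_nbr G A S| <= #|non_nbr G A u|.
    apply/subset_leq_card/subsetP => w wS.
    have wA : w \in A by case/common_nbrP: wS.
    rewrite inE wA /=; apply: (@common_nbr_clique_indep S) => //.
    apply/common_nbrP; split=> // s /(subsetP SN)/common_nbrP[_].
    by move=> /(_ _ (set11 _)); rewrite adjC.
  rewrite Sr => + /(_ SA).
  case: r r2 Dr => [|[|s]] //= _; nia.
(* The default color is only reached outside [A], by [hasP]. *)
exists (fun u => if [pick i : 'I_r | twins u (enum_val (cast_ord (esym Kr) i))] is Some i
             then i else Ordinal (ltnW r2)).
move=> u v uA vA; apply: contraTneq.
case: pickP => [i ui|none]; last by have [i0] := hasP u uA; rewrite none.
case: pickP => [j vj|none]; last by have [j0] := hasP v vA; rewrite none.
move=> ij; rewrite -ij twinsC in vj.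
apply: twins_non_adj => //; apply: twins_trans ui vj => //.
by apply/(subsetP KA)/enum_valP.
Qed.

End MinDegree.

(** * Cliques in book-free graphs *)

Section BookClique.
Variables (V : finType) (G : graph V) (r k : nat) (A : {set V}).
Hypothesis bfG : book_free G r k.
Implicit Types (S K : {set V}) (u v : V).

Lemma card_near_common_nbr K K' :
  clique G K -> #|K| = r.+1 -> K' \subset K ->
  #|\bigcup_(v in K') common_nbr G setT (K :\ v)| <= #|K'| * k.
Proof.
move=> cK Kr /subsetP K'K; apply: leq_trans (leq_card_bigcup _ _) _.
rewrite -sum_nat_const; apply: leq_sum => v /K'K Kv.
apply: ltnW; apply: bfG; first exact: cliqueS (subD1set _ _) cK.
by have := cardsD1 v K; rewrite Kv Kr => -[].
Qed.

Lemma book_clique_free D :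
  {in A, forall v, #|non_nbr G A v| <= D} -> 1 < r ->
  (r ^ 2 + r - 1) * D < r.+1 * #|A| ->
  2 * (r ^ 2 + r - 1) * (r.+1 * k) <= #|A| -> clique_free G A r.+1.
Proof.
move=> AD r2 Dr Ak K KA cK; apply/eqP => Kr.
set T := \bigcup_(v in K) common_nbr G setT (K :\ v).
have Tk : #|T| <= r.+1 * k by rewrite -Kr card_near_common_nbr.
have two u : u \in A :\: T -> 1 < \sum_(v in K) ~~ adj G v u.
  rewrite inE => /andP[uT uA].
  have far v : v \in K -> exists2 s, s \in K :\ v & ~~ adj G s u.
    move=> Kv; have : u \notin common_nbr G setT (K :\ v).
      by apply: contra uT => uv; apply/bigcupP; exists v.
    by rewrite inE in_setT /= => /forall_inPn[s]; exists s.
  have [v0 Kv0] : exists v0, v0 \in K by apply/card_gt0P; rewrite Kr.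
  have [v1 /setD1P[_ Kv1] v1u] := far v0 Kv0.
  have [v2 /setD1P[v21 Kv2] v2u] := far v1 Kv1.
  by rewrite (bigD1 v1) //= (bigD1 v2) /= ?Kv2 // v1u v2u.
have : \sum_(u in A :\: T) 2 <= \sum_(v in K) D.
  apply: leq_trans (leq_sum _ two) _; rewrite exchange_big /=.
  apply: leq_sum => v Kv; apply: leq_trans (AD v (subsetP KA v Kv)).
  rewrite -big_mkcondr /= sum1dep_card subset_leq_card //.
  by apply/subsetP => u; rewrite !inE => /andP[/andP[_ ->]].
rewrite !sum_nat_const Kr; have := cardsID T A; have := subset_leq_card (subsetIr A T).
move: Tk; clear -r2 Dr Ak => Tk IT E H.
have H1 : #|A| * 2 <= r.+1 * D + 2 * (r.+1 * k) by lia.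
set X := r ^ 2 + r - 1 in Dr Ak *.
(* This closes the chain 2 X |A| <= (r + 1) X D + |A| < ((r + 1)^2 + 1) |A| <= 2 X |A|. *)
have XE : (r.+1) ^ 2 + 1 <= 2 * X by rewrite /X; case: r r2 => [|[|s]] //= _; nia.
have H2 : X * (#|A| * 2) <= r.+1 * (X * D) + #|A| by nia.
have H3 : r.+1 * (X * D) < r.+1 * (r.+1 * #|A|) by rewrite ltn_pmul2l.
nia.
Qed.

End BookClique.

(** * Balanced sums and the number of transversals *)

(** The difference of the two sides is (s - q)(s - q - 1), which is nonnegative on integers and
    vanishes exactly at q and q + 1. *)
Lemma balanced_term q s : (2 * q + 1) * s <= s ^ 2 + q * q.+1 ?= iff (q <= s <= q.+1).
Proof.
case: (leqP s q) => [|] sq.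
  rewrite -(subnKC sq); set d := q - s; split; first by nia.
  by apply/eqP/idP; nia.
rewrite -(subnKC sq); set d := s - q.+1; split; first by nia.
by apply/eqP/idP; nia.
Qed.

Lemma balanced_sum (I : finType) (s : I -> nat) q :
  (2 * q + 1) * (\sum_i s i) <= \sum_i s i ^ 2 + #|I| * (q * q.+1)
    ?= iff [forall i, q <= s i <= q.+1].
Proof.
rewrite big_distrr /= -sum_nat_const -big_split /=.
by apply: leqif_sum => i _; apply: balanced_term.
Qed.

Lemma card_transversals (I T : finType) (D : I -> {set T}) :
  #|[set f : {ffun I -> T} | [forall i, f i \in D i]]| = \prod_i #|D i|.
Proof.
under [RHS]eq_bigr do rewrite -sum1_card.
rewrite bigA_distr_big_dep /=; under [RHS]eq_bigr do rewrite big1_eq.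
rewrite -sum1_card; apply: eq_bigl => f; rewrite inE.
by apply/forallP/familyP.
Qed.

(** * Graphs that are colorable up to one vertex *)

Section OneVertex.
Variables (V : finType) (G : graph V) (r : nat) (A : {set V}).
Variables (x : V) (c : V -> 'I_r).
Hypotheses (Ax : x \in A) (col : proper_coloring G (A :\ x) c).
Hypothesis ncol : forall c' : V -> 'I_r, ~ proper_coloring G A c'.
Implicit Types (u v y : V) (i j : 'I_r) (p : V * V).

Let B := A :\ x.
Definition part i := [set u in B | c u == i].
Definition nb i := [set u in part i | adj G x u].
(** The condition on the colors orders each pair, so that every non-edge between two classes is
    counted once. *)
Definition missing :=
  [set p | [&& p.1 \in B, p.2 \in B, c p.1 < c p.2 & ~~ adj G p.1 p.2]].

Lemma card_parts : #|B| = \sum_i #|part i|.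
Proof.
rewrite -sum1_card (partition_big c predT) //=; apply: eq_bigr => i _.
by rewrite -sum1_card; apply: eq_bigl => u; rewrite !inE.
Qed.

Lemma deg_nb : deg G A x = \sum_i #|nb i|.
Proof.
rewrite /deg -sum1_card (partition_big c predT) //=; apply: eq_bigr => i _.
rewrite -sum1_card; apply: eq_bigl => u; rewrite !inE.
by case: (eqVneq u x) => [->|_] /=; rewrite ?adjxx ?andbF // andbAC.
Qed.

(** Otherwise [x] could take color [i]. *)
Lemma nb_gt0 i : 0 < #|nb i|.
Proof.
rewrite lt0n; apply/eqP => /cards0_eq nb0.
apply: (ncol (c' := fun u => if u == x then i else c u)) => u v uA vA uv.
have noi w : w \in A -> w != x -> adj G x w -> c w != i.
  move=> wA wx xw; apply: contraPneq nb0 => cw /setP/(_ w).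
  by rewrite !inE wx wA cw eqxx xw.
case: (eqVneq u x) (eqVneq v x) => [ux|ux] [vx|vx].
- by rewrite ux vx adjxx in uv.
- by rewrite eq_sym noi // -ux.
- by rewrite noi // -vx adjC.
- by apply: col => //; rewrite !inE ?ux ?vx.
Qed.

(** An ordered pair of vertices of [B] is an arc, lies inside one class, or is missing in one of its
    two orders. The arcs at [x] are added on both sides. *)
Lemma arcs_count :
  arcs G A + \sum_i #|part i| ^ 2 + (#|missing|).*2
    = #|B| ^ 2 + (\sum_i #|nb i|).*2.
Proof.
rewrite (arcsD1 _ Ax) -/B deg_nb.
suff : arcs G B + \sum_i #|part i| ^ 2 + (#|missing|).*2 = #|B| ^ 2 by lia.
have -> : \sum_i #|part i| ^ 2 = \sum_(u in B) \sum_(v in B) (c u == c v).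
  rewrite (partition_big c predT) //=; apply: eq_bigr => i _.
  rewrite -mulnn -sum_nat_const.
  apply: eq_big => [u|u]; rewrite inE // => /andP[_ /eqP cu].
  rewrite -sum1_card big_mkcond [RHS]big_mkcond; apply: eq_bigr => v _.
  by rewrite cu eq_sym inE; case: (v \in B); case: eqP.
pose m u v : bool := (c u < c v) && ~~ adj G u v.
have mE : #|missing| = \sum_(u in B) \sum_(v in B) m u v.
  rewrite pair_big /= -sum1_card big_mkcond [RHS]big_mkcond; apply: eq_bigr => p _.
  by rewrite !inE /m; do 4?case: (_ \in _); do !case: (_ == _) => //=;
    case: (_ < _); case: adj.
rewrite -addnn {1}mE mE [X in _ + (_ + X)]exchange_big /arcs /=.
rewrite -mulnn -sum_nat_const -!big_split /=; apply: eq_bigr => u uB.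
rewrite -sum1_card -!big_split /=; apply: eq_bigr => v vB.
rewrite /m [adj G v u]adjC -(inj_eq val_inj) /=.
have := col uB vB; rewrite -(inj_eq val_inj) /=.
by case: adj => [/(_ isT)|_]; case: ltngtP.
Qed.

Lemma missing_intro u v : u \in B -> v \in B -> c u != c v -> ~~ adj G u v ->
  (u, v) \in missing \/ (v, u) \in missing.
Proof.
move=> uB vB cuv uv; rewrite [(u, v) \in _]inE [(v, u) \in _]inE /=.
rewrite uB vB /= [adj G v u]adjC uv !andbT.
by move: cuv; rewrite -(inj_eq val_inj) /=; case: ltngtP; [left|right|].
Qed.

(** A clique on r + 1 vertices must contain [x], and its other vertices take every color once. A
    neighbour [u] of [x] has the color of some [v] in [K]: either [u] is a common neighbour of the
    r-clique [K :\ v], which happens at most r k times, or it misses a vertex of [K] of another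
    color. *)
Lemma deg_le_missing k : book_free G r k ->
  forall K : {set V}, K \subset A -> clique G K -> #|K| = r.+1 ->
  deg G A x <= r * k + #|missing|.
Proof.
move=> bf K /subsetP KA cK Kr.
have cKi : {in K :\ x &, injective c}.
  move=> u v /setD1P[ux Ku] /setD1P[vx Kv] cuv; apply: contra_eq cuv => uv.
  by apply: col; rewrite ?inE ?ux ?vx ?KA //; move/cliqueP: cK; apply.
have Kx : x \in K.
  apply: contraT => Kx; have := leq_card_in c _ cKi; have := cardsD1 x K.
  by rewrite (negPf Kx) Kr card_ord add0n => <-; rewrite ltnn.
have K'r : #|K :\ x| = r by have := cardsD1 x K; rewrite Kx Kr => -[].
have onto i : exists2 v, v \in K :\ x & c v = i.
  have : c @: (K :\ x) = setT.
    by apply/eqP; rewrite eqEcard subsetT cardsT card_ord (card_in_imset cKi) K'r leqnn.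
  by move/setP/(_ i); rewrite inE => /imsetP[v Kv ->]; exists v.
set T := \bigcup_(v in K :\ x) common_nbr G setT (K :\ v).
have Tk : #|T| <= r * k by rewrite -K'r (card_near_common_nbr bf cK Kr) ?subD1set.
pose M := [set u in B | [exists v in K :\ x, (c u != c v) && ~~ adj G u v]].
have Mm : #|M| <= #|missing|.
  (* Recovers [u] from its missing pair as the end outside [K], so different [u] use different
     pairs. *)
  pose h p := if p.1 \in K then p.2 else p.1.
  apply: leq_trans (leq_imset_card h missing); apply/subset_leq_card/subsetP => u.
  rewrite inE => /andP[uB /exists_inP[v /setD1P[vx Kv] /andP[cuv uv]]].
  have vB : v \in B by rewrite !inE vx KA.
  have Ku : u \notin K.
    apply: contra uv => Ku; move/cliqueP: cK; apply=> //.
    by apply: contraNneq cuv => ->.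
  have [m|m] := missing_intro uB vB cuv uv; apply/imsetP.
    by exists (u, v); rewrite // /h /= (negPf Ku).
  by exists (v, u); rewrite // /h /= Kv.
have cover : B \subset T :|: non_nbr G B x :|: M.
  apply/subsetP => u uB; rewrite !in_setU inE uB /= -orbA.
  case uM: (u \in M); rewrite ?orbT // orbF; case xu: (adj G x u); rewrite ?orbT // orbF.
  have [v Kv cvu] := onto (c u); apply/bigcupP; exists v => //.
  apply/common_nbrP; split; rewrite ?inE // => s /setD1P[sv Ks].
  have [->//|sx] := eqVneq s x.
  move: uM; rewrite inE uB /= => /exists_inPn/(_ s); rewrite !inE sx Ks /= => /(_ isT).
  rewrite negb_and !negbK adjC => /orP[/eqP cus|//].
  by case/eqP: sv; apply: cKi => //; [rewrite !inE sx | rewrite cvu cus].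
have := subset_leq_card cover; have := deg_non_nbr G B x.
have := (leq_card_setU (T :|: non_nbr G B x) M).1.
have := (leq_card_setU T (non_nbr G B x)).1.
have : deg G B x = deg G A x.
  rewrite /deg; apply: eq_card => u; rewrite !inE.
  by case: (eqVneq u x) => [->|//]; rewrite adjxx !andbF.
lia.
Qed.

(** If a clique existed, [deg_le_missing] would cancel the degree of [x] against the missing pairs
    up to r k. With [balanced_sum] this leaves |A| <= r k + 2 q, contrary to |A| >= r q >= 3 q and r
    k < q. *)
Lemma book_extremal_clique_free k q : book_free G r k -> 2 < r -> r * k < q ->
  r * q <= #|A| ->
  #|A| ^ 2 + 3 + r * (q * q.+1) <= arcs G A + (2 * q + 1) * #|A|.+1 ->
  clique_free G A r.+1.
Proof.
move=> bf r3 rkq rqA lb K KA cK; apply/eqP => Kr.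
have := deg_le_missing bf KA cK Kr; rewrite deg_nb; have := arcs_count.
have [+ _] := balanced_sum (fun i => #|part i|) q; rewrite -card_parts card_ord /=.
have AB : #|A| = #|B|.+1 by rewrite (cardsD1 x A) Ax.
move: lb rqA; rewrite AB; set m := #|missing|; set d := \sum_i #|nb i|.
set n := #|B|; set s2 := \sum_i _; move=> *.
have : 3 * q <= r * q by rewrite leq_mul2r r3 orbT.
nia.
Qed.

Hypothesis cfA : clique_free G A r.+1.

Lemma nbP i u : reflect [/\ u \in B, c u = i & adj G x u] (u \in nb i).
Proof.
have -> : (u \in nb i) = [&& u \in B, c u == i & adj G x u].
  by rewrite !inE -!andbA.
by apply: (iffP and3P) => -[? /eqP ? ?].
Qed.

(** Together with [x] a transversal without missing pair would be a clique on r + 1 vertices. The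
    two equations say that both ends of [p] lie on the transversal. *)
Lemma transversal_missing (f : 'I_r -> V) : (forall i, f i \in nb i) ->
  exists2 p, p \in missing & f (c p.1) = p.1 /\ f (c p.2) = p.2.
Proof.
move=> fnb; have fP i := nbP _ _ (fnb i).
have cf i : c (f i) = i by case: (fP i).
have finj : injective f by apply: can_inj cf.
have fx : x \in common_nbr G setT (f @: setT).
  by apply/common_nbrP; split=> // _ /imsetP[i _ ->]; rewrite adjC; case: (fP i).
suff /existsP[i /existsP[j ij]] : [exists i, exists j, (f i, f j) \in missing].
  by exists (f i, f j); rewrite ?cf.
apply: contraT => /existsPn nof.
have cl : clique G (x |: f @: setT).
  apply: clique1U => //; apply/cliqueP => _ _ /imsetP[i _ ->] /imsetP[j _ ->] fij.
  apply: contraT => nij; have [iB _ _] := fP i; have [jB _ _] := fP j.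
  have cij : c (f i) != c (f j) by rewrite !cf; apply: contraNneq fij => ->.
  have [m|m] := missing_intro iB jB cij nij.
    by have /existsPn/(_ j) := nof i; rewrite m.
  by have /existsPn/(_ i) := nof j; rewrite m.
have sub : x |: f @: setT \subset A.
  apply/subsetP => u /setU1P[->//|/imsetP[i _ ->]].
  by case: (fP i) => /setD1P[].
have := cfA sub cl.
by rewrite (card_clique1U fx) card_imset // cardsT card_ord eqxx.
Qed.

Definition missing_nb := [set p in missing | adj G x p.1 && adj G x p.2].

(* Every transversal of the sets nb i contains a missing pair, and a pair between
   colors i and j lies in a fraction 1 / (|nb i| |nb j|) of all transversals. *)
Lemma card_missing_nb m :
  (forall i j, i != j -> m <= #|nb i| * #|nb j|) ->
  m <= #|missing_nb| /\ (#|missing_nb| <= m ->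
    {in missing_nb, forall p, #|nb (c p.1)| * #|nb (c p.2)| = m}).
Proof.
move=> mle; set N := missing_nb.
(* [W p] counts the transversals through [p]: two colors are prescribed and the others are free. *)
pose D p i := if i == c p.1 then [set p.1] else if i == c p.2 then [set p.2] else nb i.
pose W p := \prod_i #|D p i|.
pose d p := #|nb (c p.1)| * #|nb (c p.2)|.
have NP p : p \in N -> c p.1 != c p.2.
  by rewrite !inE -(inj_eq val_inj) /= neq_ltn => /andP[/and4P[_ _ ->]].
have WE p : p \in N -> d p * W p = \prod_i #|nb i|.
  move=> /NP cp; rewrite /W (bigD1 (c p.1)) //= (bigD1 (c p.2)) 1?eq_sym //=.
  rewrite [RHS](bigD1 (c p.1)) //= [in RHS](bigD1 (c p.2)) 1?eq_sym //=.
  rewrite /D eqxx eq_sym (negPf cp) eqxx !cards1 !mul1n mulnA; congr muln.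
  by apply: eq_bigr => i /andP[/negPf-> /negPf->].
have Pgt0 : 0 < \prod_i #|nb i| by apply: prodn_gt0 => i; apply: nb_gt0.
have Wgt0 p : p \in N -> 0 < W p.
  by move=> /WE pE; move: Pgt0; rewrite -pE muln_gt0 => /andP[].
have cover : \prod_i #|nb i| <= \sum_(p in N) W p.
  rewrite -card_transversals.
  pose T p := [set f : {ffun 'I_r -> V} | [forall i, f i \in D p i]].
  apply: leq_trans (_ : #|\bigcup_(p in N) T p| <= _); last first.
    apply: leq_trans (leq_card_bigcup _ _) _.
    by under eq_bigr do rewrite card_transversals.
  apply/subset_leq_card/subsetP => f; rewrite inE => /forallP fnb.
  have [p pm [f1 f2]] := transversal_missing fnb.
  apply/bigcupP; exists p.
    rewrite inE pm /= -f1 -f2.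
    by have /nbP[_ _ ->] := fnb (c p.1); have /nbP[_ _ ->] := fnb (c p.2).
  rewrite inE; apply/forallP => i; rewrite /D.
  case: eqP => [->|_]; first by rewrite f1 set11.
  by case: eqP => [->|_]; rewrite ?f2 ?set11.
have tot : \sum_(p in N) d p * W p = #|N| * \prod_i #|nb i|.
  by rewrite -sum_nat_const; apply: eq_bigr.
have le1 p : p \in N -> m * W p <= d p * W p ?= iff (d p == m).
  move=> pN; split; first by rewrite leq_mul2r mle ?orbT ?NP.
  by rewrite eqn_pmul2r ?Wgt0 // eq_sym.
have [le2 eq2] := leqif_sum le1.
have mP : m * \prod_i #|nb i| <= \sum_(p in N) m * W p.
  by rewrite -big_distrr leq_mul2l cover orbT.
split; first by rewrite -(leq_pmul2r Pgt0) -tot; apply: leq_trans mP le2.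
move=> Nm p pN; have : \sum_(p in N) m * W p == \sum_(p in N) d p * W p.
  by rewrite eqn_leq le2 tot (leq_trans _ mP) // leq_mul2r Nm orbT.
by rewrite eq2 => /forall_inP/(_ p pN)/eqP.
Qed.

Lemma sum_pair a b (F : 'I_r -> nat) : a != b ->
  \sum_i F i = F a + F b + \sum_(i | (i != a) && (i != b)) F i.
Proof. by move=> ab; rewrite (bigD1 a) // (bigD1 b) 1?eq_sym //= addnA. Qed.

(* The classes a and b enter with size + 1: this absorbs the linear terms, so that
   the bound reduces to balanced_sum for r numbers of sum |A| + 1. *)
Lemma pair_bound a b q : a != b -> #|nb a| * #|nb b| <= #|missing| ->
  [/\ arcs G A + (2 * q + 1) * #|A|.+1 <= #|A| ^ 2 + 3 + r * (q * q.+1) &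
   #|A| ^ 2 + 3 + r * (q * q.+1) <= arcs G A + (2 * q + 1) * #|A|.+1 ->
   [/\ #|missing| = #|nb a| * #|nb b|, #|nb a| = 1 \/ #|nb b| = 1,
      forall i, i != a -> i != b -> nb i = part i &
      forall i, q <= #|part i| + ((i == a) || (i == b)) <= q.+1]].
Proof.
move=> ab mab.
pose s i := #|part i| + ((i == a) || (i == b)).
have [bal bal_eq] := balanced_sum s q; rewrite card_ord in bal bal_eq.
have sE (F : nat -> nat) : \sum_i F (s i) = F #|part a|.+1 + F #|part b|.+1 +
      \sum_(i | (i != a) && (i != b)) F #|part i|.
  rewrite (sum_pair _ ab) /s !eqxx orbT !addn1; congr addn.
  by apply: eq_bigr => i /andP[/negPf-> /negPf->]; rewrite addn0.
have s1 := sE id; have s2 := sE (fun t => t ^ 2).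
have AB : #|A| = #|B|.+1 by rewrite (cardsD1 x A) Ax.
have cB := card_parts; have cnt := arcs_count.
rewrite !(sum_pair _ ab) in cB cnt.
have [rest rest_eq] : \sum_(i | (i != a) && (i != b)) #|nb i| <=
    \sum_(i | (i != a) && (i != b)) #|part i|
      ?= iff [forall (i | (i != a) && (i != b)), nb i == part i].
  apply: leqif_sum => i _; apply: subset_leqif_cards.
  by apply/subsetP => u /nbP[uB cu _]; rewrite !inE in uB *; rewrite uB cu eqxx.
have da := nb_gt0 a; have db := nb_gt0 b.
move: s1 s2 bal bal_eq cB cnt rest rest_eq; rewrite AB.
set n := #|B|; set S1 := \sum_i s i; set S2 := \sum_i s i ^ 2.
set P1 := \sum_(i | _) #|part i|; set P2 := \sum_(i | _) #|part i| ^ 2.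
set N1 := \sum_(i | _) #|nb i|.
move: da db mab; set da := #|nb a|; set db := #|nb b|; set M := #|missing|.
set ca := #|part a|; set cb := #|part b|.
move=> da0 db0 mab s1 s2 bal bal_eq cB cnt rest rest_eq.
(* This is (da - 1)(db - 1) >= 0, with equality only if one of the two is 1. *)
have dd : da + db <= (da * db).+1 by nia.
have S1n : S1 = n.+2 by lia.
rewrite S1n in bal bal_eq.
split; first by lia.
move=> lb.
(* The upper bound is the sum of four estimates, so attaining it makes each of them an equality. *)
have [E1 E2 E3 E4] : [/\ M = da * db, da + db = (da * db).+1, N1 = P1 &
    (2 * q + 1) * n.+2 = S2 + r * (q * q.+1)] by split; lia.
split.
- exact: E1.
- move: da0 db0 E2; case: (da) (db) => [|[|d]] [|[|e]] // _ _; [left|left|right|] => //.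
  by rewrite mulSn mulnS; lia.
- move=> i ia ib; apply/eqP; move/eqP: E3; rewrite rest_eq => /forall_inP; apply.
  by rewrite ia.
- by move=> i; move/eqP: E4; rewrite bal_eq => /forallP/(_ i).
Qed.

(** Let [y] be the only neighbour of [x] in class [a]. Every missing pair contains [y], so they are
    given by the set [U] of non-neighbours of [y] in other classes. Transversals through [y] force
    some [nb j] into [U], and by cardinality [nb j] equals [U]. Since x and y cannot be recolored,
    class [j] is not full, which leaves j = b. *)
Lemma extremal_structure a b : a != b ->
  (forall i j, i != j -> #|nb a| * #|nb b| <= #|nb i| * #|nb j|) ->
  #|missing| = #|nb a| * #|nb b| -> #|nb a| = 1 ->
  (forall i, i != a -> i != b -> nb i = part i /\ 1 < #|part i|) ->
  exists y, [/\ nb a = [set y], nb b \proper part b &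
    {in B &, forall u v, adj G u v = [&& c u != c v,
      ~~ ((u == y) && (v \in nb b)) & ~~ ((v == y) && (u \in nb b))]}].
Proof.
move=> ab dmin; move=> + a1; rewrite a1 mul1n => mb full.
have [y nbay] : exists y, nb a = [set y] by apply/cards1P; rewrite a1.
have /nbP[yB cy xy] : y \in nb a by rewrite nbay set11.
have bmin i : i != a -> #|nb b| <= #|nb i|.
  by rewrite eq_sym => /dmin; rewrite a1 !mul1n.
have [mle mE] := card_missing_nb dmin; rewrite a1 mul1n in mle mE.
have mnb : missing_nb = missing.
  by apply/eqP; rewrite eqEcard mb mle andbT; apply/subsetP => p; rewrite inE => /andP[].
rewrite mnb mb in mE; have {}mE := mE (leqnn _).
(* By [mE] the product over the two colors of [p] is [#|nb b|]. If neither color is [a], one factor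
   comes from a full class and is at least 2, and the other is at least [#|nb b|]. *)
have ma p : p \in missing -> (c p.1 == a) || (c p.2 == a).
  move=> pm; apply: contraT; rewrite negb_or => /andP[p1a p2a].
  have p12 : c p.1 != c p.2.
    by move: pm; rewrite !inE -(inj_eq val_inj) /= neq_ltn => /and4P[_ _ ->].
  have := mE p pm; have := bmin _ p1a; have := bmin _ p2a; have := nb_gt0 b.
  have [p1b|p1b] := eqVneq (c p.1) b.
    have p2b : c p.2 != b by rewrite -p1b eq_sym.
    by have [-> +] := full _ p2a p2b; nia.
  by have [-> +] := full _ p1a p1b; nia.
(* Both ends of a missing pair are neighbours of [x], so the end of color [a] is [y]. *)
have my p : p \in missing -> (p.1 == y) || (p.2 == y).
  move=> pm; have := ma p pm; move: (pm); rewrite -mnb inE => /andP[].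
  rewrite inE => /and4P[p1 p2 _ _] /andP[x1 x2] /orP[]/eqP ca.
    by have : p.1 \in nb a by [apply/nbP]; rewrite nbay inE => ->.
  by have : p.2 \in nb a by [apply/nbP]; rewrite nbay inE => ->; rewrite orbT.
pose U := [set u in B | (c u != a) && ~~ adj G y u].
have UP u : u \in U -> [/\ u \in B, c u != a & ~~ adj G y u].
  by rewrite inE => /and3P.
have Ub : #|U| <= #|nb b|.
  pose h p := if p.1 == y then p.2 else p.1.
  rewrite -mb; apply: leq_trans (leq_imset_card h missing).
  apply/subset_leq_card/subsetP => u /UP[uB ua yu].
  have uy : u != y by apply: contraNneq ua => ->; rewrite cy.
  rewrite eq_sym -cy in ua; apply/imsetP.
  have [m|m] := missing_intro yB uB ua yu.
    by exists (y, u); rewrite // /h /= eqxx.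
  by exists (u, y); rewrite // /h /= (negPf uy).
have missU u v : u \in B -> v \in B -> c u != c v -> ~~ adj G u v ->
    (u == y) && (v \in U) || (v == y) && (u \in U).
  move=> uB vB cuv uv.
  have UI w : w \in B -> c y != c w -> ~~ adj G y w -> w \in U.
    by move=> wB; rewrite cy eq_sym => wa yw; rewrite inE; apply/and3P.
  have /orP[/eqP E|/eqP E] : (u == y) || (v == y).
    by have [/my|/my] := missing_intro uB vB cuv uv; rewrite // orbC.
  - by rewrite E eqxx UI // -E.
  - by rewrite E eqxx (UI u) ?orbT // -E 1?eq_sym 1?adjC.
have [j ja jU] : exists2 j, j != a & nb j \subset U.
  suff /exists_inP[j] : [exists j in [pred j | j != a], nb j \subset U] by exists j.
  apply: contraT => /exists_inPn noj.
  (* A transversal through [y] that avoids [U]; by [missU] it would contain no missing pair. *)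
  pose f i := if i == a then y else odflt y [pick u in nb i :\: U].
  have fP i : i != a -> f i \in nb i :\: U.
    move=> ia; rewrite /f (negPf ia); case: pickP => //= none.
    by have /subsetPn[u ui uU] := noj i ia; have := none u; rewrite inE uU ui.
  have fnb i : f i \in nb i.
    have [->|/fP/setDP[]//] := eqVneq i a.
    by rewrite /f eqxx nbay set11.
  have [p pm [f1 f2]] := transversal_missing fnb.
  move: (pm); rewrite inE => /and4P[p1 p2 p12 np].
  have {}p12 : c p.1 != c p.2 by rewrite -(inj_eq val_inj) neq_ltn p12.
  have : (p.1 == y) && (p.2 \in U) || (p.2 == y) && (p.1 \in U) by apply: missU.
  case/orP => /andP[_ pU]; have [_ pa _] := UP _ pU.
    by have /setDP[_] := fP _ pa; rewrite f2 pU.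
  by have /setDP[_] := fP _ pa; rewrite f1 pU.
have UE : nb j = U by apply/eqP; rewrite eqEcard jU (leq_trans Ub) ?bmin.
have nbpart i : nb i \subset part i.
  by apply/subsetP => u /nbP[uB cu _]; rewrite !inE in uB *; rewrite uB cu eqxx.
(* Otherwise coloring x with a and y with j would be proper. *)
have nfull : nb j != part j.
  apply/eqP => jfull.
  apply: (ncol (c' := fun u => if u == x then a else if u == y then j else c u)).
  have yj v : v \in B -> adj G y v -> c v != j.
    move=> vB yv; apply/eqP => cv; have : v \in U.
      by rewrite -UE jfull inE vB cv eqxx.
    by case/UP=> _ _; rewrite yv.
  have xa v : v \in B -> adj G x v -> v != y -> c v != a.
    move=> vB xv; apply: contraNneq => cv.
    by have : v \in nb a by [apply/nbP]; rewrite nbay inE.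
  have BP w : w \in A -> w != x -> w \in B by move=> *; rewrite !inE; apply/andP.
  move=> u v uA vA uv; have := adj_neq uv.
  case: (eqVneq u x) (eqVneq v x) => [ux|ux] [vx|vx].
  - by rewrite ux vx eqxx.
  - case: (eqVneq v y) => [_ _|vy _]; first by rewrite eq_sym.
    by rewrite eq_sym xa ?BP // -ux.
  - case: (eqVneq u y) => // uy _.
    by rewrite xa ?BP // -vx adjC.
  case: (eqVneq u y) (eqVneq v y) => [uy|uy] [vy|vy] _.
  - by rewrite uy vy adjxx in uv.
  - by rewrite eq_sym yj ?BP // -uy.
  - by rewrite yj ?BP // -vy adjC.
  - by apply: col => //; apply: BP.
have jb : j = b.
  by apply: contraNeq nfull => jb; have [-> _] := full j ja jb.
rewrite jb in UE nfull; exists y; split=> //.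
  by rewrite properEneq nfull nbpart.
move=> u v uB vB; rewrite UE.
have [cuv|cuv] /= := eqVneq (c u) (c v).
  by apply/negP => /(col uB vB); rewrite cuv eqxx.
apply/idP/andP => [uv|[]].
  split; apply/negP => /andP[/eqP E /UP[_ _]]; first by rewrite -E uv.
  by rewrite -E adjC uv.
by move=> n1 n2; apply: contraT => /(missU _ _ uB vB cuv); rewrite (negPf n1) (negPf n2).
Qed.

End OneVertex.

(* Defined by its increments n - (n + 1) %/ r, which are what the deletion of a
   vertex is compared with; the closed form is extremal_sizeE. *)
Definition extremal_size r n := (\sum_(i < n) (i - i.+1 %/ r)).+1.

Lemma extremal_sizeS r n :
  extremal_size r n.+1 = extremal_size r n + (n - n.+1 %/ r).
Proof. by rewrite /extremal_size big_ord_recr. Qed.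

(** The equality case of [pair_bound], with twice the size in place of [arcs]. In the induction the
    quotient changes only when r divides n + 1. *)
Lemma extremal_sizeE r n : 1 < r ->
  2 * extremal_size r n + (2 * (n %/ r) + 1) * n.+1
    = n ^ 2 + 3 + r * ((n %/ r) * (n %/ r).+1).
Proof.
move=> r1; elim: n => [|n IHn].
  by rewrite /extremal_size big_ord0 div0n; lia.
rewrite extremal_sizeS divnS; last lia.
have := divn_eq n r; have := ltn_pmod n (ltnW r1).
set q := n %/ r in IHn *; set p := n %% r => pr nE.
have qn : q * 2 <= n.
  by rewrite nE; apply: leq_trans (leq_addr _ _); rewrite leq_mul2l r1 orbT.
case: (boolP (r %| n.+1)) => [|_] /=; last by rewrite add0n; lia.
rewrite nE -addnS dvdn_addr ?dvdn_mull // => /dvdn_leq => /(_ isT) rp.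
have nq : n.+1 = q * r + r by lia.
rewrite add1n -nE; lia.
Qed.

(** * Deleting vertices of low degree *)

Section Peeling.
Variables (V : finType) (G : graph V) (r k : nat).
Hypotheses (r3 : 2 < r) (k1 : 0 < k) (bfG : book_free G r k).
Implicit Types (A : {set V}) (u v x y : V).

Let X := r ^ 2 + r - 1.

Lemma low_degree_vertex A : 2 * X * (r.+1 * k) <= #|A| -> ~~ colorable G r A ->
  exists2 v, v \in A & r.+1 * #|A| <= X * #|non_nbr G A v|.
Proof.
move=> Ak ncol; apply/exists_inP; apply: contraT => /exists_inPn low.
(* The largest [D] with X D < (r + 1) |A|, as both [book_clique_free] and [min_degree_colorable]
   require. *)
pose D := (r.+1 * #|A| - 1) %/ X.
have X0 : 0 < X by rewrite /X; case: r r3 => // s _; nia.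
have A0 : 0 < #|A| by apply: leq_trans Ak; rewrite !muln_gt0 X0 k1.
have AD : {in A, forall v, #|non_nbr G A v| <= D}.
  move=> v vA; rewrite leq_divRL // mulnC; have := low v vA; lia.
have Dr : X * D < r.+1 * #|A|.
  by have := leq_trunc_div (r.+1 * #|A| - 1) X; rewrite -/D; nia.
have cf := book_clique_free bfG AD (ltnW r3) Dr Ak.
by case/negP: ncol; apply/colorableP/(min_degree_colorable AD (ltnW r3) cf Dr).
Qed.

(** Since r (r + 1) = X + 1, the number of non-neighbours exceeds |A| / r by a fixed fraction of
    |A|. Once the quotient exceeds [X] there are at least two more than the quotient, so [deg G A v]
    is below the increment of [extremal_size]. *)
Lemma low_degree_size A v : X < #|A| %/ r -> v \in A ->
  r.+1 * #|A| <= X * #|non_nbr G A v| ->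
  (deg G A v).+1 + extremal_size r #|A :\ v| <= extremal_size r #|A|.
Proof.
move=> Xq vA low; have AE : #|A| = #|A :\ v|.+1 by rewrite (cardsD1 v A) vA.
rewrite [in X in _ <= X]AE extremal_sizeS -AE.
have := deg_non_nbr G A v; set nn := #|non_nbr G A v| in low *.
have := leq_trunc_div #|A| r; set q := #|A| %/ r in Xq *.
suff : q + 2 <= nn by lia.
have XE : X.+1 = r * r.+1 by rewrite /X; case: r r3 => // s _; nia.
rewrite leqNgt; apply/negP => nnq.
have : X * nn <= X * q.+1 by rewrite leq_mul2l; apply/orP; right; lia.
nia.
Qed.

(** The first summand is the size needed by [book_clique_free]; the second makes the quotient by [r]
    exceed X + r k. *)
Definition peel_bound := 2 * X * (r.+1 * k) + r * (X + r * k).+1.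

Lemma peel_bound_quotient n : peel_bound <= n -> X + r * k < n %/ r.
Proof. by rewrite leq_divRL ?(ltn_trans _ r3) // /peel_bound; lia. Qed.

Lemma peel_bound_low n : peel_bound <= n -> 2 * X * (r.+1 * k) <= n.
Proof. by apply: leq_trans; apply: leq_addr. Qed.

Lemma one_vertex_extremal A x (c : V -> 'I_r) (q := #|A| %/ r) :
  x \in A -> proper_coloring G (A :\ x) c -> ~~ colorable G r A ->
  r * k < q -> 2 * extremal_size r #|A| <= arcs G A ->
  let N := nb G A x c in let P := part A x c in
  arcs G A = 2 * extremal_size r #|A| /\
  exists a b y, [/\ a != b, N a = [set y], N b \proper P b,
    forall i, i != a -> i != b -> N i = P i &
    forall i, q <= #|P i| + ((i == a) || (i == b)) <= q.+1] /\
    {in A :\ x &, forall u v, adj G u v = [&& c u != c v,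
      ~~ ((u == y) && (v \in N b)) & ~~ ((v == y) && (u \in N b))]}.
Proof.
move=> xA col ncol kq lb N P.
have ncol' (c' : V -> 'I_r) : ~ proper_coloring G A c'.
  by move=> cP; case/negP: ncol; apply/colorableP; exists c'.
have := extremal_sizeE #|A| (ltnW r3); rewrite -/q => E.
have {}lb : #|A| ^ 2 + 3 + r * (q * q.+1) <= arcs G A + (2 * q + 1) * #|A|.+1 by lia.
have rq : r * q <= #|A| by rewrite mulnC leq_trunc_div.
have cf := book_extremal_clique_free xA col bfG r3 kq rq lb.
(* The two colors are chosen to minimize the product, which turns [card_missing_nb] into a bound by
   this very pair. *)
have [[a b] /= ab abmin] : exists2 p : 'I_r * 'I_r, p.1 != p.2 &
    forall i j, i != j -> #|N p.1| * #|N p.2| <= #|N i| * #|N j|.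
  have r0 : 0 < r by apply: ltn_trans r3.
  pose p0 := (Ordinal r0, Ordinal (ltnW r3)).
  have p0P : p0.1 != p0.2 by [].
  case: (arg_minnP (P := fun p => p.1 != p.2) (fun p => #|N p.1| * #|N p.2|) p0P).
  by move=> p pP pmin; exists p => // i j ij; apply: (pmin (i, j)).
have [mab _] := card_missing_nb xA col ncol' cf abmin.
have {}mab : #|N a| * #|N b| <= #|missing G A x c|.
  apply: leq_trans mab _; apply/subset_leq_card/subsetP => p.
  by rewrite inE => /andP[].
have [ub /(_ lb)[mE one full bal]] := pair_bound xA col ncol' q ab mab.
split; first by lia.
have q1 : 1 < q by apply: leq_trans kq; rewrite ltnS muln_gt0 k1 (ltn_trans _ r3).
have fullP i : i != a -> i != b -> N i = P i /\ 1 < #|P i|.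
  move=> ia ib; split; first exact: full.
  have := bal i; rewrite (negPf ia) (negPf ib) addn0 => /andP[qi _].
  exact: leq_trans qi.
have [a1|b1] := one.
  have [y [Na Nb adjE]] := extremal_structure xA col ncol' cf ab abmin mE a1 fullP.
  by exists a, b, y; split=> //; split.
(* If instead [nb b] is the singleton, the same argument runs with a and b exchanged. *)
have ba : b != a by rewrite eq_sym.
have bamin i j : i != j -> #|N b| * #|N a| <= #|N i| * #|N j|.
  by rewrite mulnC; apply: abmin.
have mE' : #|missing G A x c| = #|N b| * #|N a| by rewrite mulnC.
have [i ib ia|y [Nb Na adjE]] := extremal_structure xA col ncol' cf ba bamin mE' b1.
  exact: fullP.
exists b, a, y; split=> //; split=> // [i ib ia|i]; first exact: full.
by rewrite orbC; apply: bal.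
Qed.

Lemma one_vertex_le A x : x \in A -> peel_bound <= #|A| -> ~~ colorable G r A ->
  colorable G r (A :\ x) -> arcs G A <= 2 * extremal_size r #|A|.
Proof.
move=> xA /peel_bound_quotient qA ncol /colorableP[c col].
have kq : r * k < #|A| %/ r by apply: leq_ltn_trans qA; apply: leq_addl.
have [/(one_vertex_extremal xA col ncol kq)[-> //]|/ltnW//] :=
  leqP (2 * extremal_size r #|A|) (arcs G A).
Qed.

Lemma peeling_step A : peel_bound <= #|A| -> ~~ colorable G r A ->
  exists2 v, v \in A & arcs G A + 2 + 2 * extremal_size r #|A :\ v|
    <= arcs G (A :\ v) + 2 * extremal_size r #|A|.
Proof.
move=> An ncol; have [v vA low] := low_degree_vertex (peel_bound_low An) ncol.
have qA : X < #|A| %/ r by apply: leq_ltn_trans (peel_bound_quotient An); apply: leq_addr.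
exists v => //; have := low_degree_size qA vA low; rewrite (arcsD1 G vA); lia.
Qed.

Lemma peeling A : peel_bound <= #|A| -> ~~ colorable G r A ->
  arcs G A <= 2 * extremal_size r #|A| + 2 * (peel_bound ^ 2 - (#|A| - peel_bound)).
Proof.
move nE : #|A| => n; elim: n A nE => [|n IHn] A nE An ncol.
  by have := arcs_le G A; rewrite nE; lia.
have [nb|nb] := leqP n.+1 peel_bound.
  have nbE : n.+1 = peel_bound by apply/eqP; rewrite eqn_leq nb.
  by have := arcs_le G A; rewrite nE nbE subnn subn0; lia.
have An' : peel_bound <= #|A| by rewrite nE.
have [v vA step] := peeling_step An' ncol.
have nE' : #|A :\ v| = n by move: nE; rewrite (cardsD1 v A) vA => -[].
have [colv|ncolv] := boolP (colorable G r (A :\ v)).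
  by have := one_vertex_le vA An' ncol colv; rewrite nE; lia.
have := IHn _ nE' nb ncolv; rewrite nE nE' in step; lia.
Qed.

(** If the set left by a peeling step were not colorable, its surplus would be at least 2, while
    [peeling] allows none at this size. *)
Lemma extremal_one_vertex A : peel_bound + peel_bound ^ 2 < #|A| -> ~~ colorable G r A ->
  2 * extremal_size r #|A| <= arcs G A -> exists2 v, v \in A & colorable G r (A :\ v).
Proof.
move=> An ncol lb.
have An' : peel_bound <= #|A| by lia.
have [v vA step] := peeling_step An' ncol; exists v => //.
apply: contraT => ncolv.
have AE : #|A| = #|A :\ v|.+1 by rewrite (cardsD1 v A) vA.
have Av : peel_bound <= #|A :\ v| by lia.
have := peeling Av ncolv.
have -> : peel_bound ^ 2 - (#|A :\ v| - peel_bound) = 0 by lia.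
lia.
Qed.

End Peeling.

(** * Blow-ups and isomorphisms *)

Definition fiber (V L : finType) (h : V -> L) (l : L) := [set v | h v == l].

Lemma card_fibers (V L : finType) (h : V -> L) : #|V| = \sum_l #|fiber h l|.
Proof.
rewrite -sum1_card (partition_big h predT) //=; apply: eq_bigr => l _.
by rewrite -sum1_card; apply: eq_bigl => v; rewrite inE.
Qed.

(** Each vertex is sent to the vertex of the same rank in the enumeration of the corresponding
    fiber. *)
Lemma bij_of_fibers (V W L : finType) (h : V -> L) (h' : W -> L) :
  (forall l, #|fiber h l| = #|fiber h' l|) ->
  exists f : V -> W, bijective f /\ forall v, h' (f v) = h v.
Proof.
move=> hh'.
pose rk (U : finType) (g : U -> L) (u : U) := index u (enum (fiber g (g u))).
have ex v : exists w, h' w = h v /\ rk _ h' w = rk _ h v.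
  have iv : rk _ h v < size (enum (fiber h' (h v))).
    by rewrite -cardE -hh' cardE index_mem mem_enum inE.
  case sE : (enum (fiber h' (h v))) iv => [//|w0 s] iv.
  set w := nth w0 (w0 :: s) (rk _ h v).
  have : w \in fiber h' (h v) by rewrite -mem_enum sE mem_nth.
  rewrite inE => /eqP hw; exists w; split=> //.
  by rewrite {1}/rk hw sE index_uniq // -sE enum_uniq.
have [f fP] := fin_all_exists ex; exists f; split; last by move=> v; case: (fP v).
apply: inj_card_bij; last first.
  by rewrite (card_fibers h) (card_fibers h') (eq_bigr _ (fun l _ => hh' l)).
move=> u v fuv; have [hu ru] := fP u; have [hv rv] := fP v.
have huv : h u = h v by rewrite -hu -hv fuv.
have : rk _ h u = rk _ h v by rewrite -ru -rv fuv.
rewrite /rk huv => iuv; apply: (index_inj u) iuv; last by rewrite mem_enum inE.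
by rewrite mem_enum inE huv.
Qed.

(** Says that [G] is a blow-up of [H] along [h]. By [iso_of_models] the sizes of the fibers then
    determine [G] up to isomorphism. *)
Definition model_of (V W : finType) (H : graph W) (G : graph V) (h : V -> W) :=
  forall u v, adj G u v = adj H (h u) (h v).

Lemma iso_of_models (V V' W : finType) (H : graph W) (G : graph V) (G' : graph V')
    (h : V -> W) (h' : V' -> W) :
  model_of H G h -> model_of H G' h' ->
  (forall l, #|fiber h l| = #|fiber h' l|) -> isomorphic G G'.
Proof.
move=> hG hG' hh'; have [f [fbij fh]] := bij_of_fibers hh'.
by exists f; split=> // u v; rewrite hG' !fh hG.
Qed.

Lemma iso_trans (V1 V2 V3 : finType) (G1 : graph V1) (G2 : graph V2) (G3 : graph V3) :
  isomorphic G1 G2 -> isomorphic G2 G3 -> isomorphic G1 G3.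
Proof.
move=> [f [fbij fG]] [g [gbij gG]]; exists (g \o f); split; first exact: bij_comp.
by move=> u v; rewrite /= gG fG.
Qed.

Lemma iso_refl (V : finType) (G : graph V) : isomorphic G G.
Proof. by exists id; split=> //; exists id. Qed.

Lemma model_of_iso (V V' W : finType) (H : graph W) (G : graph V) (G' : graph V')
    (h' : V' -> W) : isomorphic G G' -> model_of H G' h' ->
  exists2 h : V -> W, model_of H G h & forall l, #|fiber h l| = #|fiber h' l|.
Proof.
move=> [f [fbij fG]] hG'; exists (h' \o f) => [u v|l]; first by rewrite -fG hG'.
rewrite -(card_imset _ (bij_inj fbij)); have [g fK gK] := fbij.
apply: eq_card => w; apply/imsetP/idP => [[v + ->]|]; first by rewrite !inE.
by rewrite inE => hw; exists (g w); rewrite ?gK // inE /= gK.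
Qed.

Lemma adj_joinl (V W : finType) (G : graph V) (H : graph W) u v :
  adj (join G H) (inl u) (inl v) = adj G u v.
Proof.
rewrite adj_graph_of [adj G v u]adjC orbb andbC; case uv : (adj G u v) => //=.
by apply/eqP => -[E]; rewrite E adjxx in uv.
Qed.

Lemma adj_joinr (V W : finType) (G : graph V) (H : graph W) u v :
  adj (join G H) (inr u) (inr v) = adj H u v.
Proof.
rewrite adj_graph_of [adj H v u]adjC orbb andbC; case uv : (adj H u v) => //=.
by apply/eqP => -[E]; rewrite E adjxx in uv.
Qed.

Lemma adj_joinlr (V W : finType) (G : graph V) (H : graph W) u v :
  adj (join G H) (inl u) (inr v).
Proof. by rewrite adj_graph_of. Qed.

Lemma adj_joinrl (V W : finType) (G : graph V) (H : graph W) u v :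
  adj (join G H) (inr u) (inl v).
Proof. by rewrite adj_graph_of. Qed.

Definition adj_join := (adj_joinl, adj_joinr, adj_joinlr, adj_joinrl).

Lemma iso_join (V V' W : finType) (G : graph V) (G' : graph V') (H : graph W) :
  isomorphic G G' -> isomorphic (join G H) (join G' H).
Proof.
move=> [f [[g fK gK] fG]].
exists (fun u => match u with inl v => inl (f v) | inr w => inr w end); split.
  by exists (fun u => match u with inl v => inl (g v) | inr w => inr w end);
    case=> // v; rewrite ?fK ?gK.
by case=> u [] v; rewrite !adj_join.
Qed.

Lemma adj_complete n (i j : 'I_n) : adj (complete_graph n) i j = (i != j).
Proof. by rewrite adj_graph_of andbT. Qed.

Lemma adj_cycle5 (i j : 'I_5) :
  adj cycle5 i j = (j == i.+1 %% 5 :> nat) || (i == j.+1 %% 5 :> nat).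
Proof.
rewrite adj_graph_of andbC; case: (eqVneq i j) => [->|]; last by rewrite /= andbT.
by case: j => -[|[|[|[|[|j]]]]].
Qed.

Lemma adj_blowup (V : finType) (H : graph V) s a b :
  adj (blowup H s) a b = adj H (tag a) (tag b).
Proof.
rewrite adj_graph_of [adj H _ (tag a)]adjC orbb andbC.
case ab : (adj H _ _) => //=; apply/eqP => E; by rewrite E adjxx in ab.
Qed.

Lemma adj_turan m N (x y : 'I_N) : adj (turan m N) x y = (x %% m != y %% m).
Proof.
rewrite adj_graph_of [y %% m == _]eq_sym orbb andbC.
by case xy : (x %% m != y %% m) => //=; apply: contraTneq xy => ->; rewrite eqxx.
Qed.

Lemma card_tag_fiber (V : finType) (s : V -> nat) (i : V) :
  #|[set w : {v : V & 'I_(s v)} | tag w == i]| = s i.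
Proof.
rewrite -[RHS]card_ord -(card_imset predT (f := fun j => Tagged (fun v => 'I_(s v)) j)).
  apply: eq_card => -[v j]; rewrite inE /=.
  apply/eqP/imsetP => [vi|[j' _ /(congr1 tag)] //].
  by case: _ / vi; exists j.
by move=> j j' /eqP; rewrite eq_Tagged /= => /eqP.
Qed.

Definition turan_part m N i := \sum_(x < N) (x %% m == i).

(** Every block of [m] consecutive numbers meets each residue once. Allowing N = m covers the case
    where all parts have size Q + 1. *)
Lemma turan_part_add m N Q i : N <= m -> i < m ->
  turan_part m (m * Q + N) i = Q + (i < N).
Proof.
move=> Nm im; rewrite /turan_part -(big_mkord xpredT (fun x => (x %% m == i) : nat)).
have base M : M <= m -> \sum_(0 <= x < M) (x %% m == i) = (i < M).
  move=> Mm; rewrite big_mkord; case: ltnP => [iM|Mi].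
    rewrite (bigD1 (Ordinal iM)) //= modn_small // eqxx big1 // => x xi.
    rewrite modn_small ?(leq_trans (ltn_ord x)) //.
    by apply/eqP; rewrite eqb0; apply: contra xi => /eqP E; apply/eqP/val_inj.
  rewrite big1 // => x _; rewrite modn_small ?(leq_trans (ltn_ord x)) //.
  by apply/eqP; rewrite eqb0 ltn_eqF // (leq_trans (ltn_ord x)).
elim: Q => [|Q IHQ]; first by rewrite muln0 base.
rewrite (@big_cat_nat _ _ _ m) //=; last by rewrite mulnS -addnA leq_addr.
rewrite base // im.
have := big_addn 0 (m * Q.+1 + N) m xpredT (fun x => (x %% m == i) : nat).
rewrite add0n => ->; rewrite mulnS -addnA addKn.
by under eq_bigr do rewrite modnDr; rewrite IHQ.
Qed.

Lemma turan_part_bounds m N q i : i < m -> q * m <= N <= q.+1 * m ->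
  q <= turan_part m N i <= q.+1.
Proof.
move=> im /andP[qN Nq]; rewrite -(subnKC qN) mulnC turan_part_add //; last by nia.
by case: (i < _); rewrite /= ?addn0 ?addn1 leqnn ?leqnSn.
Qed.

Lemma sum_turan_part m N : 0 < m -> \sum_(i < m) turan_part m N i = N.
Proof.
move=> m0; rewrite exchange_big /= -[RHS]card_ord -sum1_card; apply: eq_bigr => x _.
rewrite (bigD1 (Ordinal (ltn_pmod x m0))) //= eqxx big1 // => i xi.
by apply/eqP; rewrite eqb0; apply: contra xi => /eqP E; apply/eqP/val_inj.
Qed.

(** * Joins of blown-up 5-cycles with Turan graphs *)

(** All extremal graphs are blow-ups of this one graph, with m = r - 2. *)
Definition pattern_graph m := join cycle5 (complete_graph m).

Definition std_graph m n1 n2 n5 N := join (C5 n1 n2 1 1 n5) (turan m N).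

Definition std_size m n1 n2 n5 N (l : 'I_5 + 'I_m) :=
  match l with
  | inl i => nth 0 [:: n1; n2; 1; 1; n5] i
  | inr j => turan_part m N j
  end.

Lemma std_graph_model m n1 n2 n5 N : 0 < m -> exists2 h,
  model_of (pattern_graph m) (std_graph m n1 n2 n5 N) h &
  forall l, #|fiber h l| = std_size n1 n2 n5 N l.
Proof.
move=> m0.
pose s5 (i : 'I_5) := nth 0 [:: n1; n2; 1; 1; n5] i.
pose h (w : {v : 'I_5 & 'I_(s5 v)} + 'I_N) : 'I_5 + 'I_m :=
  match w with inl w => inl (tag w) | inr z => inr (Ordinal (ltn_pmod z m0)) end.
exists h.
  by case=> u [] v; rewrite !adj_join // ?adj_blowup ?adj_turan ?adj_complete.
case=> [i|j] /=; rewrite /fiber -sum1dep_card big_sumType /=.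
  rewrite [X in _ + X]big1 ?addn0 // sum1dep_card.
  rewrite -[RHS]/(s5 i) -card_tag_fiber.
  by apply: eq_card => w; rewrite !inE (inj_eq inl_inj).
rewrite big1 // add0n /turan_part big_mkcond; apply: eq_bigr => x _.
by rewrite (inj_eq inr_inj) -(inj_eq val_inj) /=; case: eqP.
Qed.

Lemma sum_fibers (V L : finType) (h : V -> L) (F : L -> nat) :
  \sum_v F (h v) = \sum_l #|fiber h l| * F l.
Proof.
rewrite (partition_big h predT) //=; apply: eq_bigr => l _.
rewrite -sum_nat_const; apply: eq_big => v; first by rewrite inE.
by move=> /eqP->.
Qed.

Section Pattern.
Variables (V : finType) (G : graph V) (m : nat) (h : V -> 'I_5 + 'I_m).
Hypothesis hG : model_of (pattern_graph m) G h.

(** Arcs are counted by pairs of fibers. Adding the squares of the fibers over the complete part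
    completes its count to T^2. *)
Lemma pattern_arcs (s : 'I_5 -> nat) (t : 'I_m -> nat) :
  (forall i, #|fiber h (inl i)| = s i) -> (forall j, #|fiber h (inr j)| = t j) ->
  let S := \sum_i s i in let T := \sum_j t j in
  arcs G setT + \sum_j t j ^ 2 =
    \sum_i s i * (\sum_j s j * adj cycle5 i j) + 2 * S * T + T ^ 2.
Proof.
move=> hs ht S T.
have -> : arcs G setT =
    \sum_l #|fiber h l| * \sum_l' #|fiber h l'| * adj (pattern_graph m) l l'.
  rewrite -(sum_fibers h (fun l => \sum_l' #|fiber h l'| * adj (pattern_graph m) l l')).
  rewrite /arcs; apply: eq_big => [u|u _]; rewrite ?inE //.
  rewrite (eq_bigl xpredT) => [|v]; last by rewrite inE.
  by under eq_bigr do rewrite hG; rewrite (sum_fibers h (fun l => adj _ (h u) l : nat)).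
rewrite big_sumType /=.
have E1 i : #|fiber h (inl i)| *
      (\sum_l' #|fiber h l'| * adj (pattern_graph m) (inl i) l')
    = s i * (\sum_j s j * adj cycle5 i j) + s i * T.
  rewrite hs big_sumType /= mulnDr; congr (_ * _ + _ * _); apply: eq_bigr => j _.
    by rewrite hs adj_join.
  by rewrite ht adj_join muln1.
have E2 j : #|fiber h (inr j)| *
      (\sum_l' #|fiber h l'| * adj (pattern_graph m) (inr j) l')
    + t j ^ 2 = t j * S + t j * T.
  rewrite ht big_sumType /= mulnDr -addnA; congr (_ * _ + _).
    by apply: eq_bigr => i _; rewrite hs adj_join muln1.
  rewrite -mulnn -mulnDr; congr (_ * _); rewrite /T (bigD1 j) // [in RHS](bigD1 j) //=.
  rewrite adj_join adjxx muln0 add0n addnC; congr (_ + _).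
  by apply: eq_bigr => i ij; rewrite ht adj_join adj_complete eq_sym ij muln1.
rewrite (eq_bigr _ (fun i _ => E1 i)) -addnA -big_split /= (eq_bigr _ (fun j _ => E2 j)).
rewrite !big_split /= -!big_distrl /= -/S -/T; ring.
Qed.

(** Representatives of the complete part use up [m] colors, and the 5-cycle cannot be colored with
    the remaining two. *)
Lemma pattern_not_colorable : (forall l, 0 < #|fiber h l|) -> ~~ colorable G m.+2 setT.
Proof.
move=> h0; apply/colorableP => -[c cP].
have [rep repP] : exists rep, forall l, h (rep l) = l.
  apply: (@fin_all_exists _ (fun=> V) (fun l v => h v = l)) => l.
  have /card_gt0P[v] := h0 l.
  by rewrite inE => /eqP; exists v.
pose d l := c (rep l).
have dP l l' : adj (pattern_graph m) l l' -> d l != d l'.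
  by move=> ll'; apply: cP; rewrite ?inE // hG !repP.
have dinj : injective (fun j => d (inr j)).
  move=> i j /eqP; apply: contraTeq => ij; apply: dP.
  by rewrite adj_join adj_complete.
pose S := [set d (inr j) | j : 'I_m].
have : #|~: S| == 2.
  by have := cardsC S; rewrite card_imset // !card_ord; lia.
move/cards2P=> [p [q [pq SE]]].
have dS i : (d (inl i) == p) || (d (inl i) == q).
  have : d (inl i) \in ~: S.
    rewrite inE; apply/imsetP => -[j _ E].
    by have := dP (inl i) (inr j); rewrite adj_join E eqxx => /(_ isT).
  by rewrite SE !inE.
pose o i (lt : i < 5) : 'I_5 := Ordinal lt.
have adjd (i j : 'I_5) : adj cycle5 i j -> d (inl i) != d (inl j).
  by move=> ij; apply: dP; rewrite adj_join.
have := adjd (@o 0 isT) (@o 1 isT); have := adjd (@o 1 isT) (@o 2 isT).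
have := adjd (@o 2 isT) (@o 3 isT); have := adjd (@o 3 isT) (@o 4 isT).
have := adjd (@o 4 isT) (@o 0 isT); rewrite !adj_cycle5 /=.
move=> /(_ isT) + /(_ isT) + /(_ isT) + /(_ isT) + /(_ isT).
have := dS (@o 0 isT); have := dS (@o 1 isT); have := dS (@o 2 isT).
have := dS (@o 3 isT); have := dS (@o 4 isT).
by do 5!case/orP=> /eqP->; rewrite ?eqxx.
Qed.

(** [h] is injective on a clique, so m + 3 vertices would put a triangle into the 5-cycle. *)
Lemma pattern_clique_free : clique_free G setT m.+3.
Proof.
move=> K _ /cliqueP cK; apply/eqP => Km.
have hinj : {in K &, injective h}.
  move=> u v Ku Kv huv; apply: contra_eq huv => uv; have := cK u v Ku Kv uv.
  by rewrite hG; apply: adj_neq.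
pose C := [set i : 'I_5 | inl i \in h @: K].
have : #|h @: K| <= #|C| + m.
  rewrite -sum1_card big_sumType /= sum1dep_card leq_add2l.
  by rewrite sum1dep_card -[m in _ <= m]card_ord max_card.
rewrite card_in_imset // Km => C2; have {}C2 : 2 < #|C| by lia.
have /card_gt2P[i [j [l [[iC jC lC] [ij jl li]]]]] := C2.
have adjC i' j' : i' \in C -> j' \in C -> i' != j' -> adj cycle5 i' j'.
  rewrite !inE => /imsetP[u Ku hu] /imsetP[v Kv hv] ij'.
  rewrite -(adj_joinl cycle5 (complete_graph m)) hu hv -hG.
  apply: cK => //; apply: contraNneq ij' => uv.
  by have [->] : inl i' = inl j' :> 'I_5 + 'I_m by rewrite hu hv uv.
have := adjC _ _ iC jC ij; have := adjC _ _ jC lC jl; have := adjC _ _ lC iC li.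
rewrite !adj_cycle5; clear.
by case: i j l => -[|[|[|[|[|i]]]]] // ? [[|[|[|[|[|j]]]]] // ?] [[|[|[|[|[|l]]]]] // ?].
Qed.

End Pattern.

(* All the graphs of G1, G2 and G3 at once: with n1 + 2 = q + i and
   t + s + 1 = q + j, the pair (i, j) is (0, 0) for G1, (0, 1) or (1, 0) for G2
   and (1, 1) for G3. *)
Definition extremal_params m q n n1 t s N :=
  [/\ 0 < t, 0 < s, q <= n1 + 2 <= q.+1, q <= t + s + 1 <= q.+1 &
      q * m <= N <= q.+1 * m /\ n1 + t + s + 2 + N = n].

(** The numbers n1 + 2, t + s + 1 and the Turan part sizes are m + 2 numbers of sum n + 1, each q or
    q + 1: the equality case of the quadratic bound. *)
Lemma std_extremal (V : finType) (G : graph V) m n n1 t s N (q := n %/ m.+2) :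
  0 < m -> 2 < q -> extremal_params m q n n1 t s N ->
  isomorphic G (std_graph m n1 t s N) ->
  [/\ #|V| = n, ~~ colorable G m.+2 setT, clique_free G setT m.+3 &
      arcs G setT = 2 * extremal_size m.+2 n].
Proof.
move=> m0 q2 [t0 s0 n1q tsq [Nq nE]] iso.
have [h' h'M h'F] := std_graph_model n1 t s N m0.
have [h hM hF] := model_of_iso iso h'M.
have fE l : #|fiber h l| = std_size n1 t s N l by rewrite hF h'F.
have pb j : j < m -> q <= turan_part m N j <= q.+1 by move=> jm; apply: turan_part_bounds.
split.
- rewrite (card_fibers h) (eq_bigr _ (fun l _ => fE l)) big_sumType /=.
  by rewrite (sum_turan_part N m0) !big_ord_recl big_ord0 /=; lia.
- apply: (pattern_not_colorable hM) => -[i|j]; rewrite fE /=.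
    by case: i => -[|[|[|[|[|i]]]]] //= _; lia.
  by have /andP[+ _] := pb j (ltn_ord j); lia.
- exact: pattern_clique_free hM.
have := pattern_arcs hM (fun i => fE (inl i)) (fun j => fE (inr j)).
rewrite /std_size (sum_turan_part N m0) !big_ord_recl !big_ord0 !adj_cycle5 /= => E.
have := extremal_sizeE n (isT : 1 < m.+2); rewrite -/q => E2.
have [_ ] := balanced_sum (fun j : 'I_m => turan_part m N j) q.
rewrite sum_turan_part // card_ord.
have -> : [forall i : 'I_m, q <= turan_part m N i <= q.+1].
  by apply/forallP => j; apply: pb.
move=> /eqP bal; set T2 := \sum_(j < m) _ in E bal.
have H1 : (n1 + 2) ^ 2 + q * q.+1 = (2 * q + 1) * (n1 + 2).
  by have := (balanced_term q (n1 + 2)).2; rewrite n1q => /eqP.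
have H2 : (t + s + 1) ^ 2 + q * q.+1 = (2 * q + 1) * (t + s + 1).
  by have := (balanced_term q (t + s + 1)).2; rewrite tsq => /eqP.
clear -E E2 bal H1 H2 nE; subst n; move: E E2 bal H1 H2.
lia.
Qed.

(** * Recognizing the extremal graphs *)

Lemma sum_two_values (I : finType) (Q : pred I) (s : I -> nat) q :
  (forall i, Q i -> q <= s i <= q.+1) ->
  \sum_(i | Q i) s i = #|Q| * q + #|[set i | Q i & s i == q.+1]|.
Proof.
move=> sq; rewrite -sum_nat_const -sum1dep_card big_mkcondr -big_split /=.
by apply: eq_bigr => i /sq /andP[s1 s2]; case: eqVneq => [->|]; lia.
Qed.

(** For numbers that are all q or q + 1, the sum and the number of terms determine how often each
    value occurs. *)
Lemma card_two_values (I J : finType) (Q : pred I) (s : I -> nat) (s' : J -> nat) q :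
  (forall i, Q i -> q <= s i <= q.+1) -> (forall j, q <= s' j <= q.+1) ->
  #|Q| = #|J| -> \sum_(i | Q i) s i = \sum_j s' j ->
  forall e, #|[set i | Q i & (s i == q.+1) == e]| = #|[set j | (s' j == q.+1) == e]|.
Proof.
move=> sq s'q QJ; rewrite (sum_two_values sq).
have JT : #|(predT : pred J)| = #|J| by apply: eq_card.
rewrite (sum_two_values (Q := predT) (fun j _ => s'q j)) JT QJ => /addnI eqT.
have E1 : #|[set i | Q i & (s i == q.+1) == true]| = #|[set j | (s' j == q.+1) == true]|.
  by move: eqT; congr (_ = _); apply: eq_card => i; rewrite !inE eqb_id.
case=> //.
have C1 := cardsID [set i | s i == q.+1] [set i | Q i].
have C2 := cardsID [set j | s' j == q.+1] setT.
have D1 : #|[set i | Q i] :&: [set i | s i == q.+1]| = #|[set i | Q i & (s i == q.+1) == true]|.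
  by apply: eq_card => i; rewrite !inE eqb_id.
have D2 : #|setT :&: [set j | s' j == q.+1]| = #|[set j | (s' j == q.+1) == true]|.
  by apply: eq_card => i; rewrite !inE eqb_id.
have D3 : #|[set i | Q i] :\: [set i | s i == q.+1]| = #|[set i | Q i & (s i == q.+1) == false]|.
  by apply: eq_card => i; rewrite !inE eqbF_neg andbC.
have D4 : #|setT :\: [set j | s' j == q.+1]| = #|[set j | (s' j == q.+1) == false]|.
  by apply: eq_card => i; rewrite !inE eqbF_neg andbT.
have Q1 : #|[set i | Q i]| = #|Q| by apply: eq_card => i; rewrite inE.
move: C1 C2; rewrite D1 D2 D3 D4 Q1 QJ cardsT; lia.
Qed.

Section StructureIso.
Variables (V : finType) (G : graph V) (m : nat) (x y : V) (c : V -> 'I_m.+2).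
Variables (a b : 'I_m.+2) (q : nat).
Let P := part setT x c.
Let N := nb G setT x c.
Let B := [set: V] :\ x.
Hypotheses (m0 : 0 < m) (ab : a != b) (Na : N a = [set y]) (Nb : N b \subset P b).
Hypothesis full : forall i, i != a -> i != b -> N i = P i.
Hypothesis bal : forall i, i != a -> i != b -> q <= #|P i| <= q.+1.
Hypothesis adjE : {in B &, forall u v, adj G u v = [&& c u != c v,
  ~~ ((u == y) && (v \in N b)) & ~~ ((v == y) && (u \in N b))]}.

Let R := \sum_(i | (i != a) && (i != b)) #|P i|.

Lemma card_other_colors : #|[pred i | (i != a) && (i != b)]| = m.
Proof.
have -> : #|[pred i | (i != a) && (i != b)]| = #|predC (mem [set a; b])|.
  by apply: eq_card => i; rewrite !inE negb_or.
by have := cardC (mem [set a; b]); rewrite cards2 ab card_ord => -[].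
Qed.

Lemma other_total_bounds : q * m <= R <= q.+1 * m.
Proof.
rewrite /R (sum_two_values (Q := [pred i | (i != a) && (i != b)]) (q := q)); last first.
  by move=> i /andP[]; apply: bal.
rewrite card_other_colors mulnC leq_addr /= mulnC mulSn addnC leq_add2r.
rewrite (leq_trans _ (eq_leq card_other_colors)) //.
by apply/subset_leq_card/subsetP => i; rewrite !inE => /andP[].
Qed.

(** The classes other than [a] and [b] have the same sizes as the parts of the Turan graph on [R]
    vertices and are matched by size; the two Booleans stand for [a] and [b]. *)
Lemma color_bijection : exists f : 'I_m.+2 -> bool + 'I_m,
  [/\ injective f, f a = inl true, f b = inl false &
   forall i, i != a -> i != b -> exists2 j, f i = inr j & #|P i| = turan_part m R j] /\
  forall j, exists2 i, f i = inr j & (i != a) && (i != b).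
Proof.
pose h i : bool + bool := if i == a then inl true else if i == b then inl false
  else inr (#|P i| == q.+1).
pose h' (w : bool + 'I_m) : bool + bool :=
  match w with inl e => inl e | inr j => inr (turan_part m R j == q.+1) end.
have tb (j : 'I_m) : q <= turan_part m R j <= q.+1.
  by apply: turan_part_bounds => //; apply: other_total_bounds.
have ba : b != a by rewrite eq_sym.
have hh' l : #|fiber h l| = #|fiber h' l|.
  case: l => [e|e].
    transitivity 1.
      rewrite -(cards1 (if e then a else b)); apply: eq_card => i; rewrite !inE /h.
      case: e; case: (eqVneq i a) => [ia|ia]; rewrite ?ia ?(negPf ab) //;
        by case: (eqVneq i b).
    rewrite -(cards1 (inl e : bool + 'I_m)); apply: eq_card => -[e'|j]; rewrite !inE //=.
  rewrite /fiber -[RHS]sum1dep_card big_sumType /= big1 // add0n sum1dep_card.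
  transitivity #|[set i | (i != a) && (i != b) & (#|P i| == q.+1) == e]|.
    apply: eq_card => i; rewrite !inE /h.
    by case: (eqVneq i a) => //; case: (eqVneq i b).
  rewrite (card_two_values (Q := [pred i | (i != a) && (i != b)])
     (s' := fun j : 'I_m => turan_part m R j) (q := q)) //.
  - by move=> i /andP[]; apply: bal.
  - by rewrite card_ord card_other_colors.
  - by rewrite sum_turan_part.
have [f [[g fK gK] fh]] := bij_of_fibers hh'; exists f.
have fa : f a = inl true by have := fh a; rewrite /h eqxx; case: (f a) => //= e [->].
have fb : f b = inl false.
  by have := fh b; rewrite /h eqxx (negPf ba); case: (f b) => //= e [->].
split.
  split=> //; first exact: can_inj fK.
  move=> i ia ib; have := fh i; rewrite /h (negPf ia) (negPf ib).
  case: (f i) => //= j [E]; exists j => //.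
  have /andP[p1 p2] := bal ia ib; have /andP[t1 t2] := tb j.
  by move: E; case: eqVneq => [->|tn] /esym; [move/eqP | move/eqP => pn]; lia.
move=> j; exists (g (inr j)); first exact: gK.
by apply/andP; split; apply/eqP => E; have := gK (inr j); rewrite E ?fa ?fb.
Qed.

Lemma structure_iso :
  isomorphic G (std_graph m (#|P a| - 1) (#|P b| - #|N b|) #|N b| R).
Proof.
have [f [[finj fa fb fo] fsur]] := color_bijection.
have ba : b != a by rewrite eq_sym.
pose o i (lt : i < 5) : 'I_5 := Ordinal lt.
(* Around the cycle: the rest of class [a], the rest of class [b], [y], [x], and the neighbours of
   [x] in class [b]. *)
pose h u : 'I_5 + 'I_m := if u == x then inl (@o 3 isT) else
  match f (c u) with
  | inl true => inl (if u == y then @o 2 isT else @o 0 isT)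
  | inl false => inl (if u \in N b then @o 4 isT else @o 1 isT)
  | inr j => inr j
  end.
have NP i u : u \in N i -> [/\ u != x, c u = i & adj G x u].
  by rewrite !inE => /andP[/andP[/andP[-> _] /eqP]].
have PE i u : (u \in P i) = (u != x) && (c u == i).
  by rewrite !inE andbT.
have NI u : u != x -> (u \in N (c u)) = adj G x u.
  by move=> ux; rewrite !inE ux eqxx.
have /NP[yx cy xy] : y \in N a by rewrite Na set11.
have BP u : u != x -> u \in B by move=> ux; rewrite !inE ux.
have hx : h x = inl (@o 3 isT) by rewrite /h eqxx.
have spec u : u != x -> [\/ c u = a /\ h u = inl (if u == y then @o 2 isT else @o 0 isT),
    c u = b /\ h u = inl (if u \in N b then @o 4 isT else @o 1 isT) |
    [/\ c u != a, c u != b & exists2 j, f (c u) = inr j & h u = inr j]].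
  move=> ux; rewrite /h (negPf ux).
  have [ca|ca] := eqVneq (c u) a; first by constructor 1; rewrite ca fa.
  have [cb|cb] := eqVneq (c u) b; first by constructor 2; rewrite cb fb.
  by constructor 3; split=> //; have [j fj _] := fo _ ca cb; exists j; rewrite ?fj.
have notb u : c u != b -> u \in N b = false.
  by move=> cub; apply/negP => /NP[_ cu _]; rewrite cu eqxx in cub.
have noty u : c u != a -> u == y = false.
  by move=> cua; apply/negP => /eqP uy; rewrite uy cy eqxx in cua.
have hM1 u : u != x -> adj G x u = adj (pattern_graph m) (h x) (h u).
  move=> ux; rewrite hx -NI //; have [[cu ->]|[cu ->]|[ca cb [j fj ->]]] := spec u ux.
  - by rewrite cu Na inE adj_join; case: eqP; rewrite adj_cycle5.
  - by rewrite cu adj_join; case: (u \in N b); rewrite adj_cycle5.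
  - by rewrite full // !inE ux eqxx adj_join.
have hM : model_of (pattern_graph m) G h.
  move=> u v; have [->|ux] := eqVneq u x.
    have [->|vx] := eqVneq v x; last exact: hM1.
    by rewrite !adjxx.
  have [->|vx] := eqVneq v x; first by rewrite adjC hM1 // adjC.
  rewrite adjE ?BP //.
  have [[cu ->]|[cu ->]|[cua cub [j fj ->]]] := spec u ux;
  have [[cv ->]|[cv ->]|[cva cvb [l fl ->]]] := spec v vx.
  - rewrite cu cv eqxx adj_join; do 2!case: (_ == y); by rewrite adj_cycle5.
  - rewrite cu cv ab (noty v) ?cv // andbT adj_join.
    by case: (u == y); case: (v \in N b); rewrite adj_cycle5.
  - by rewrite cu [a == _]eq_sym cva (notb v) // (noty v) // andbF adj_join.
  - rewrite cu cv ba (noty u) ?cu // adj_join /=.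
    by case: (v == y); case: (u \in N b); rewrite adj_cycle5.
  - by rewrite cu cv eqxx adj_join; do 2!case: (_ \in N b); rewrite adj_cycle5.
  - by rewrite cu [b == _]eq_sym cvb (noty v) // (notb v) // andbF adj_join.
  - by rewrite cv cua (noty u) // (notb u) // !andbF adj_join.
  - by rewrite cv cub (noty u) // (notb u) // !andbF adj_join.
  - rewrite (notb u) // (notb v) // !andbF !andbT adj_join adj_complete.
    congr negb; apply/eqP/eqP => [E|E]; first by move: fj; rewrite E fl => -[].
    by apply: finj; rewrite fj fl E.
have [h' h'M h'F] := std_graph_model (#|P a| - 1) (#|P b| - #|N b|) #|N b| R m0.
apply: iso_of_models hM h'M _ => l; rewrite h'F; case: l => [i|j] /=; last first.
  have [i fi /andP[ia ib]] := fsur j; have [j' fj' Pi] := fo _ ia ib.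
  have {fj'} jj : j' = j by move: fj'; rewrite fi => -[].
  rewrite jj in Pi; rewrite -Pi; apply: eq_card => u; rewrite inE PE.
  have [->|ux] := eqVneq u x; first by rewrite hx.
  have [[cu ->]|[cu ->]|[cua cub [l fl ->]]] := spec u ux.
  - by rewrite cu [a == _]eq_sym (negPf ia).
  - by rewrite cu [b == _]eq_sym (negPf ib).
  apply/eqP/eqP => [[E]|E]; first by apply: finj; rewrite fl fi E.
  by move: fl; rewrite E fi => -[->].
have hE u : u != x -> h u = if c u == a then inl (if u == y then @o 2 isT else @o 0 isT)
    else if c u == b then inl (if u \in N b then @o 4 isT else @o 1 isT) else h u.
  move=> ux; have [[cu ->]|[cu ->]|[cua cub _]] := spec u ux.
  - by rewrite cu eqxx.
  - by rewrite cu eqxx (negPf ba).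
  - by rewrite (negPf cua) (negPf cub).
have hother u : u != x -> c u != a -> c u != b -> exists j, h u = inr j.
  move=> ux cua cub; have [[cu _]|[cu _]|[_ _ [j _ ->]]] := spec u ux; last by exists j.
  - by rewrite cu eqxx in cua.
  - by rewrite cu eqxx in cub.
have yPa : y \in P a by rewrite PE yx cy eqxx.
have ynb : y \in N b = false by apply: notb; rewrite cy.
case: i => -[|[|[|[|[|i]]]]] // lt /=.
- have -> : #|P a| - 1 = #|P a :\ y| by have := cardsD1 y (P a); rewrite yPa; lia.
  apply: eq_card => u; rewrite inE in_setD1 PE.
  have [->|ux] := eqVneq u x; first by rewrite hx andbF.
  rewrite (hE u ux); have [ca|ca] := eqVneq (c u) a; first by case: (u == y).
  have [cb|cb] := eqVneq (c u) b; first by (case: (u \in N b); rewrite /= ?andbF).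
  by have [j ->] := hother u ux ca cb; rewrite /= andbF.
- have -> : #|P b| - #|N b| = #|P b :\: N b|.
    by rewrite cardsD (setIidPr Nb).
  apply: eq_card => u; rewrite inE in_setD PE.
  have [->|ux] := eqVneq u x; first by rewrite hx andbF.
  rewrite (hE u ux); have [ca|ca] := eqVneq (c u) a.
    by rewrite ca (negPf ab) /= andbF; case: (u == y).
  have [cb|cb] := eqVneq (c u) b; first by (case: (u \in N b); rewrite /= ?andbT).
  by have [j ->] := hother u ux ca cb; rewrite /= ?andbF.
- rewrite -[RHS](cards1 y); apply: eq_card => u; rewrite !inE.
  have [->|ux] := eqVneq u x; first by rewrite hx [x == y]eq_sym (negPf yx).
  rewrite (hE u ux); have [ca|ca] := eqVneq (c u) a; first by case: (u == y).
  rewrite (noty u ca); have [cb|cb] := eqVneq (c u) b; first by case: (u \in N b).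
  by have [j ->] := hother u ux ca cb.
- rewrite -[RHS](cards1 x); apply: eq_card => u; rewrite !inE.
  have [->|ux] := eqVneq u x; first by rewrite hx.
  rewrite (hE u ux); have [ca|ca] := eqVneq (c u) a; first by case: (u == y).
  have [cb|cb] := eqVneq (c u) b; first by case: (u \in N b).
  by have [j ->] := hother u ux ca cb.
apply: eq_card => u; rewrite inE.
have [->|ux] := eqVneq u x.
  by rewrite hx; apply/esym/negP => /NP[]; rewrite eqxx.
rewrite (hE u ux); have [ca|ca] := eqVneq (c u) a.
  by rewrite (notb u) ?ca //; case: (u == y).
have [cb|cb] := eqVneq (c u) b; first by case: (u \in N b).
by rewrite (notb u cb); have [j ->] := hother u ux ca cb.
Qed.

End StructureIso.

Lemma extremal_iso (V : finType) (G : graph V) m k (n := #|V|) (q := n %/ m.+2)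
    (n0 := peel_bound m.+2 k) :
  0 < m -> 0 < k -> book_free G m.+2 k -> ~~ colorable G m.+2 setT -> n0 + n0 ^ 2 < n ->
  2 * extremal_size m.+2 n <= arcs G setT ->
  arcs G setT = 2 * extremal_size m.+2 n /\
  exists n1 t s N, extremal_params m q n n1 t s N /\ isomorphic G (std_graph m n1 t s N).
Proof.
move=> m0 k0 bf ncol n0n lb; have r3 : 2 < m.+2 by [].
have nE : #|[set: V]| = n by rewrite cardsT.
rewrite -nE in lb n0n.
have [x _ colx] := extremal_one_vertex r3 k0 bf n0n ncol lb.
have /colorableP[c cP] := colx.
have n0n' : n0 <= n by rewrite -nE; lia.
have qk := peel_bound_quotient r3 k0 n0n'.
have kq : m.+2 * k < #|[set: V]| %/ m.+2 by rewrite nE; lia.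
have [aE [a [b [y [[ab Na Nb full bal] adjE]]]]] :=
  one_vertex_extremal r3 k0 bf (in_setT x) cP ncol kq lb.
rewrite nE -/q in aE bal kq; split=> //.
set P := part setT x c in Nb full bal *.
set N := nb G setT x c in Na Nb full adjE *.
have bal' i : i != a -> i != b -> q <= #|P i| <= q.+1.
  by move=> ia ib; have := bal i; rewrite (negPf ia) (negPf ib) addn0.
(* With these values n1 + 2 and t + s + 1 are |P a| + 1 and |P b| + 1, the numbers bounded by
   [bal]. *)
exists (#|P a| - 1), (#|P b| - #|N b|), #|N b|, (\sum_(i | (i != a) && (i != b)) #|P i|).
have [NbP NPb] := (proper_sub Nb, proper_card Nb).
have q2 : 1 < q.
  have : 0 < m.+2 * k by rewrite muln_gt0.
  lia.
have ncol' (c' : V -> 'I_m.+2) : ~ proper_coloring G setT c'.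
  by move=> c'P; case/negP: ncol; apply/colorableP; exists c'.
have sE : #|P a| + #|P b| + \sum_(i | (i != a) && (i != b)) #|P i| + 1 = n.
  by rewrite -(sum_pair _ ab) -card_parts -nE (cardsD1 x setT) inE addnC.
have := bal a; have := bal b; rewrite !eqxx orbT /= => balb bala.
split; last exact: (@structure_iso _ _ _ x y c a b q).
split; rewrite ?subn_gt0 //.
- exact: (nb_gt0 cP ncol' b).
- lia.
- lia.
split; last by move: sE; set R := \sum_(i | _) _; lia.
exact: (other_total_bounds ab bal').
Qed.

(** Needed because [ex_succ] ranges over graphs on ['I_n] only. *)
Lemma relabel (W : finType) (H : graph W) n : #|W| = n ->
  exists G : graph 'I_n, isomorphic G H.
Proof.
move=> Wn; pose f (i : 'I_n) := enum_val (cast_ord (esym Wn) i).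
have finj : injective f by move=> i j /enum_val_inj/cast_ord_inj.
exists (graph_of (fun i j => adj H (f i) (f j))), f; split.
  by apply: inj_card_bij => //; rewrite card_ord Wn.
move=> i j; rewrite adj_graph_of [adj H (f j) _]adjC orbb.
by case: eqVneq => [->|]; rewrite ?adjxx.
Qed.

Definition extremal_class m q n : gclass := fun V G =>
  exists n1 t s N, extremal_params m q n n1 t s N /\ isomorphic G (std_graph m n1 t s N).

Lemma extremal_params_exist m q p : 2 < q -> p <= m.+1 ->
  exists n1 t s N, extremal_params m q (q * m.+2 + p) n1 t s N.
Proof.
move=> q2; rewrite leq_eqVlt => /orP[/eqP->|pm].
  (* For p = m + 1 the parameters must be of type [G3]; for smaller p type [G2] is available. *)
  by exists (q - 1), 1, (q - 1), (q * m + m); split; try lia; split; lia.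
by exists (q - 2), 1, (q - 1), (q * m + p); split; try lia; split; lia.
Qed.

Lemma rpartite_colorable (V : finType) (G : graph V) r :
  rpartite r G = colorable G r setT.
Proof. by apply/rpartiteP/colorableP. Qed.

(** * The extremal number and the extremal graphs *)

Section Extremal.
Variables (m k n q p : nat).
Hypotheses (m0 : 0 < m) (k0 : 0 < k) (q2 : 2 < q) (pm : p <= m.+1).
Hypotheses (nE : n = q * m.+2 + p) (n0n : peel_bound m.+2 k + peel_bound m.+2 k ^ 2 < n).

Let qE : n %/ m.+2 = q.
Proof. by rewrite nE divnMDl // divn_small ?addn0. Qed.

Lemma admissible_extremal (V : finType) (G : graph V) :
  #|V| = n -> admissible m.+2 (book m.+2 k) G ->
  #|edges G| <= extremal_size m.+2 n /\
  (#|edges G| = extremal_size m.+2 n -> extremal_class m q n G).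
Proof.
move=> Vn /andP[]; rewrite rpartite_colorable => ncol nbook.
have bf : book_free G m.+2 k.
  move=> S cS Sr; rewrite ltnNge; apply: contra nbook.
  exact: contains_book cS Sr.
have := @extremal_iso _ G m k m0 k0 bf ncol; rewrite Vn qE arcs_edges => /(_ n0n).
move=> ext; split.
  by rewrite leqNgt; apply/negP => lt; have [] := ext; lia.
by move=> eE; have [|_ ?] := ext; first lia.
Qed.

Lemma extremal_class_admissible (V : finType) (G : graph V) :
  extremal_class m q n G ->
  [/\ #|V| = n, admissible m.+2 (book m.+2 k) G & #|edges G| = extremal_size m.+2 n].
Proof.
move=> [n1 [t [s [N []]]]]; have := q2; rewrite -qE => q2' params iso.
have [Vn ncol cf aE] := std_extremal m0 q2' params iso.
split=> //; last by move: aE; rewrite arcs_edges; lia.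
by rewrite /admissible rpartite_colorable ncol clique_free_contains.
Qed.

Lemma ex_succ_book : ex_succ m.+2 n (book m.+2 k) = extremal_size m.+2 n.
Proof.
apply/eqP; rewrite eqn_leq; apply/andP; split.
  apply/bigmax_leqP => G adm.
  by have [] := admissible_extremal (card_ord n) adm.
have [n1 [t [s [N params]]]] := extremal_params_exist q2 pm; rewrite -nE in params.
have ext0 : extremal_class m q n (std_graph m n1 t s N).
  by exists n1, t, s, N; split=> //; apply: iso_refl.
have [Wn _ _] := extremal_class_admissible ext0.
have [G iso] := relabel (std_graph m n1 t s N) Wn.
have ext : extremal_class m q n G by exists n1, t, s, N.
have [_ adm <-] := extremal_class_admissible ext.
exact: (leq_bigmax_cond (F := fun G : graph 'I_n => #|edges G|)).
Qed.

Lemma Ex_succ_book : gclass_eq (Ex_succ m.+2 n (book m.+2 k)) (extremal_class m q n).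
Proof.
move=> V G; split=> [[Vn adm eE]|ext].
  by have [_] := admissible_extremal Vn adm; apply; rewrite eE ex_succ_book.
by have [] := extremal_class_admissible ext; rewrite -ex_succ_book; split.
Qed.

End Extremal.

(** * The closed formula and the three classes *)

Lemma join_class_C5 (V : finType) (G : graph V) n1 (g : nat -> nat) d m N :
  join_class (fun U F => exists t, 1 <= t <= d /\ isomorphic F (C5 n1 t 1 1 (g t)))
    (turan m N) G <->
  exists t, 1 <= t <= d /\ isomorphic G (std_graph m n1 t (g t) N).
Proof.
split=> [[U [F [[t [td isoF]] isoG]]]|[t [td iso]]].
  by exists t; split=> //; apply: iso_trans isoG _; apply: iso_join.
by do 2!eexists; split; last exact: iso; exists t; split=> //; apply: iso_refl.
Qed.

Lemma extremal_size_formula r q p : 2 < r -> p < r ->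
  ((extremal_size r (q * r + p))%:R =
     (1 - 1 / r%:R) * ((q * r + p)%:R ^+ 2 / 2) - (q * r + p)%:R / r%:R
     + p%:R * (p%:R + 2) / (2 * r%:R) - p%:R / 2 + 1 :> rat)%R.
Proof.
move=> r2 pr; have := extremal_sizeE (q * r + p) (ltnW r2).
rewrite divnMDl ?divn_small ?addn0 //; last exact: ltn_trans r2.
set f := extremal_size _ _ => E.
(* Only sums and products remain, so that the cast to the rationals distributes. *)
have {E} : f + f + (q + q + 1) * (q * r + p + 1)
    = (q * r + p) * (q * r + p) + 1 + 1 + 1 + r * (q * (q + 1)) by lia.
move/(congr1 (fun t : nat => (t%:R : rat)%R)).
have : (r%:R != 0 :> rat)%R by rewrite Num.Theory.pnatr_eq0; lia.
clearbody f; rewrite !(GRing.natrD, GRing.natrM).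
move: (r%:R)%R (q%:R)%R (p%:R)%R (f%:R)%R => R Q P F R0 E.
have -> : F = (((Q * R + P) ^+ 2 + 3 + R * (Q * (Q + 1))
  - (2 * Q + 1) * (Q * R + P + 1)) / 2)%R by lra.
by field.
Qed.

Section Classes.
Variables (V : finType) (G : graph V) (m q p : nat).

Lemma G1_std : G1 m.+2 q p G <-> exists t, 1 <= t <= q - 2 /\
  isomorphic G (std_graph m (q - 2) t (q - 1 - t) (q * m + p + 1)).
Proof.
rewrite /G1 /C5_3 (_ : (2 * q - 1 - 1) %/ 2 = q - 1); last lia.
by rewrite -subnDA !subSS subn0; apply: (join_class_C5 _ _ (fun t => q - 1 - t)).
Qed.

Lemma G3_std : G3 m.+2 q p G <-> exists t, 1 <= t <= q - 1 /\
  isomorphic G (std_graph m (q - 1) t (q - t) (q * m + p - 1)).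
Proof.
rewrite /G3 /C5_3 (_ : (2 * q + 1 - 1) %/ 2 = q); last lia.
by rewrite !subSS subn0; apply: (join_class_C5 _ _ (fun t => q - t)).
Qed.

Lemma G2_std : G2 m.+2 q p G <->
  (exists t, 1 <= t <= q - 1 /\
     isomorphic G (std_graph m (q - 2) t (q - t) (q * m + p))) \/
  (exists t, 1 <= t <= q - 2 /\
     isomorphic G (std_graph m (q - 1) t (q - t - 1) (q * m + p))).
Proof.
rewrite -(join_class_C5 _ _ (fun t => q - t)) -(join_class_C5 _ _ (fun t => q - t - 1)).
rewrite /G2 /C5_1 /C5_2 /gunion mulKn // !subSS subn0.
split=> [[U [F [[FU|FU] iso]]]|[] [U [F [FU iso]]]].
- by left; exists U, F.
- by right; exists U, F.
- by exists U, F; split=> //; left.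
- by exists U, F; split=> //; right.
Qed.

Hypotheses (q2 : 2 < q) (pm : p <= m.+1).
Let n := q * m.+2 + p.

Lemma G1_extremal : p.+1 <= m -> G1 m.+2 q p G -> extremal_class m q n G.
Proof.
move=> p1 /G1_std[t [tq iso]]; exists (q - 2), t, (q - 1 - t), (q * m + p + 1).
by split=> //; split; try lia; rewrite /n; split; lia.
Qed.

Lemma G2_extremal : p <= m -> G2 m.+2 q p G -> extremal_class m q n G.
Proof.
move=> p1 /G2_std[] [t [tq iso]].
  exists (q - 2), t, (q - t), (q * m + p).
  by split=> //; split; try lia; rewrite /n; split; lia.
exists (q - 1), t, (q - t - 1), (q * m + p).
by split=> //; split; try lia; rewrite /n; split; lia.
Qed.

Lemma G3_extremal : 1 <= p -> G3 m.+2 q p G -> extremal_class m q n G.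
Proof.
move=> p1 /G3_std[t [tq iso]]; exists (q - 1), t, (q - t), (q * m + p - 1).
by split=> //; split; try lia; rewrite /n; split; lia.
Qed.

(** The bounds q m <= N <= (q + 1) m decide which classes occur: N is q m + p + 1, q m + p or q m +
    p - 1, which requires p <= m - 1, p <= m or p >= 1 respectively. *)
Lemma extremal_classP : extremal_class m q n G ->
  [\/ p.+1 <= m /\ G1 m.+2 q p G, p <= m /\ G2 m.+2 q p G | 1 <= p /\ G3 m.+2 q p G].
Proof.
move=> [n1 [t [s [N [[t0 s0 n1q tsq [Nq nE]] iso]]]]].
have [n1E|n1E] : n1 = q - 2 \/ n1 = q - 1 by lia.
  have [sE|sE] : s = q - 1 - t \/ s = q - t by lia.
    have NE : N = q * m + p + 1 by rewrite /n in nE; lia.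
    rewrite n1E sE NE in iso; constructor 1; split; first by rewrite /n in nE; lia.
    by apply/G1_std; exists t; split=> //; lia.
  have NE : N = q * m + p by rewrite /n in nE; lia.
  rewrite n1E sE NE in iso; constructor 2; split; first by rewrite /n in nE; lia.
  by apply/G2_std; left; exists t; split=> //; lia.
have [sE|sE] : s = q - t - 1 \/ s = q - t by lia.
  have NE : N = q * m + p by rewrite /n in nE; lia.
  rewrite n1E sE NE in iso; constructor 2; split; first by rewrite /n in nE; lia.
  by apply/G2_std; right; exists t; split=> //; lia.
have [p1 NE] : 1 <= p /\ N = q * m + p - 1 by rewrite /n in nE; lia.
rewrite n1E sE NE in iso; constructor 3; split=> //.
by apply/G3_std; exists t; split=> //; lia.
Qed.

End Classes.

Theorem theorem1 (r k : nat) (hr : 3 <= r) (hk : 1 <= k) :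
  exists n0 : nat, forall n q p : nat, n0 <= n -> n = q * r + p -> p <= r - 1 ->
    ((ex_succ r n (book r k))%:R =
       (1 - 1 / r%:R) * (n%:R ^+ 2 / 2) - n%:R / r%:R
       + p%:R * (p%:R + 2) / (2 * r%:R) - p%:R / 2 + 1 :> rat)%R
    /\ [/\ p = 0 ->
             gclass_eq (Ex_succ r n (book r k)) (gunion (G1 r q p) (G2 r q p)),
           1 <= p <= r - 3 ->
             gclass_eq (Ex_succ r n (book r k))
               (gunion (gunion (G1 r q p) (G2 r q p)) (G3 r q p)),
           p = r - 2 ->
             gclass_eq (Ex_succ r n (book r k)) (gunion (G2 r q p) (G3 r q p))
         & p = r - 1 ->
             gclass_eq (Ex_succ r n (book r k)) (G3 r q p)].
Proof.
have [m rE] : exists m, r = m.+2 by exists (r - 2); lia.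
subst r; have m0 : 0 < m by lia.
(* The summand [3 * m.+2] ensures q >= 3, so that the 5-cycle classes are taken in their meaningful
   range. *)
exists ((peel_bound m.+2 k + peel_bound m.+2 k ^ 2).+1 + 3 * m.+2) => n q p n0n nE pr.
have q2 : 2 < q by rewrite ltnNge; apply/negP => q2; nia.
have pm : p <= m.+1 by lia.
have {}n0n : peel_bound m.+2 k + peel_bound m.+2 k ^ 2 < n by lia.
split.
  rewrite (ex_succ_book m0 hk q2 pm nE n0n) nE.
  by apply: extremal_size_formula; lia.
have ExE := Ex_succ_book m0 hk q2 pm nE n0n.
have G1E V (G : graph V) : p.+1 <= m -> G1 m.+2 q p G -> Ex_succ m.+2 n (book m.+2 k) G.
  by move=> pm1 H; apply/ExE; rewrite nE; apply: G1_extremal.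
have G2E V (G : graph V) : p <= m -> G2 m.+2 q p G -> Ex_succ m.+2 n (book m.+2 k) G.
  by move=> pm1 H; apply/ExE; rewrite nE; apply: G2_extremal.
have G3E V (G : graph V) : 1 <= p -> G3 m.+2 q p G -> Ex_succ m.+2 n (book m.+2 k) G.
  by move=> pm1 H; apply/ExE; rewrite nE; apply: G3_extremal.
have ExP V (G : graph V) : Ex_succ m.+2 n (book m.+2 k) G ->
  [\/ p.+1 <= m /\ G1 m.+2 q p G, p <= m /\ G2 m.+2 q p G | 1 <= p /\ G3 m.+2 q p G].
  by move/ExE; rewrite nE; apply: extremal_classP.
split=> hp V G; split.
- by case/ExP=> -[? ?]; [left|right|lia].
- by case; [apply: G1E; lia | apply: G2E; lia].
- by case/ExP=> -[? ?]; [left; left|left; right|right].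
- by case=> [[]|]; [apply: G1E; lia | apply: G2E; lia | apply: G3E; lia].
- by case/ExP=> -[? ?]; [lia|left|right].
- by case; [apply: G2E; lia | apply: G3E; lia].
- by case/ExP=> -[? ?]; [lia|lia|].
- by apply: G3E; lia.
Qed.
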